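(* Let $k\ge 1$, let $\Lambda$ be a locally convex row-finite $k$-graph and let $K$ be a field. Suppose that $\Lambda$ is strongly aperiodic, and that $\Lambda^0_{\ge v}:=\{w\in\Lambda^0: v\Lambda w\ne\emptyset\}$ is finite for every $v\in\Lambda^0$. Then the following are equivalent: (1) $v\Lambda\ne\{v\}$ for every vertex $v\in\Lambda^0$. (2) Every vertex of $\Lambda$ is reached from a cycle. (3) $\mathrm{KP}_K(\Lambda)$ is properly purely infinite. (4) $\mathrm{KP}_K(\Lambda)$ is purely infinite.
   Context: Higher-rank graphs. $\mathbb{N}=\{0,1,2,\dots\}$; $\mathbb{N}^k$ has generators $e_1,\dots,e_k$ and the coordinatewise order. A $k$-graph is a countable small category $\Lambda$ (objects $\Lambda^0$, called vertices and identified with identity morphisms; morphisms called paths; range and source $r,s:\Lambda\to\Lambda^0$; $\lambda\mu$ defined iff $s(\lambda)=r(\mu)$) with a functor $d:\Lambda\to\mathbb{N}^k$ such that for each $\lambda$ and $0\le n\le d(\lambda)$ there is a unique factorisation $\lambda=\lambda(0,n)\lambda(n,d(\lambda))$ with $d(\lambda(0,n))=n$, $d(\lambda(n,d(\lambda)))=d(\lambda)-n$. For $E\subseteq\Lambda$, $H\subseteq\Lambda^0$: $HE=\{\lambda\in E:r(\lambda)\in H\}$, $EH=\{\lambda\in E:s(\lambda)\in H\}$, with $vE$, $Ev$ when $H=\{v\}$, and $v\Lambda w=v\Lambda\cap\Lambda w$. $\Lambda^n=d^{-1}(n)$ and $\Lambda^{\le n}=\{\lambda: d(\lambda)\le n,\text{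 and } d(\lambda)+e_i\le n\Rightarrow s(\lambda)\Lambda^{e_i}=\emptyset\}$. $\Lambda$ is row-finite if $v\Lambda^n$ is finite for all $v\in\Lambda^0,n\in\mathbb{N}^k$; locally convex if for all $i\ne j$ and $\lambda\in\Lambda^{e_i}$, $r(\lambda)\Lambda^{e_j}\ne\emptyset$ implies $s(\lambda)\Lambda^{e_j}\neq\emptyset$. A cycle is a path $\mu\in\Lambda\setminus\Lambda^0$ with $s(\mu)=r(\mu)$; a vertex $v$ is reached from the cycle $\mu$ if $v\Lambda s(\mu)\ne\emptyset$. Boundary paths. For $m\in(\mathbb{N}\cup\{\infty\})^k$, $\Omega_{k,m}=\{(p,q)\in\mathbb{N}^k\times\mathbb{N}^k:p\le q\le m\}$ is the $k$-graph with $d(p,q)=q-p$, $r(p,q)=(p,p)$, $s(p,q)=(q,q)$. A boundary path is a degree-preserving functor $x:\Omega_{k,m}\to\Lambda$ such that $p\in\mathbb{N}^k$, $p\le m$, $p_i=m_i$ imply $x(p,p)\Lambda^{e_i}=\emptyset$; $d(x)=m$, $r(x)=x(0,0)$; $\Lambda^{\le\infty}$ is the set of boundary paths and $v\Lambda^{\le\infty}$ those with range $v$. For $\lambda\in\Lambda$ and $x\in s(\lambda)\Lambda^{\le\infty}$, $\lambda x$ is the concatenated boundary path. $\Lambda$ is aperiodic if for each $v\in\Lambda^0$ there is $x\in v\Lambda^{\le\infty}$ such that $\alpha\ne\beta\in\Lambda v$ implies $\alpha x\ne\beta x$. $H\subseteq\Lambda^0$ is hereditary if $r(\lambda)\in H$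 implies $s(\lambda)\in H$; saturated if for all $v\in\Lambda^0$, $n\in\mathbb{N}^k$, $\{s(\lambda):\lambda\in v\Lambda^{\le n}\}\subseteq H$ implies $v\in H$. For $H$ saturated hereditary, $\Lambda\setminus\Lambda H$ is a locally convex row-finite $k$-graph with vertex set $\Lambda^0\setminus H$. $\Lambda$ is strongly aperiodic if $\Lambda\setminus\Lambda H$ is aperiodic for every saturated hereditary $H$. Kumjian-Pask algebra. $\mathrm{KP}_K(\Lambda)$ is the universal $K$-algebra generated by $\{s_\lambda,s_{\lambda^*}:\lambda\in\Lambda\}$ (with $s_{v^*}=s_v$ for $v\in\Lambda^0$) subject to: (KP1) $s_vs_w=\delta_{v,w}s_v$ for $v,w\in\Lambda^0$; (KP2) $s_\lambda s_\mu=s_{\lambda\mu}$ and $s_{\mu^*}s_{\lambda^*}=s_{(\lambda\mu)^*}$ if $s(\lambda)=r(\mu)$; (KP3) $s_{\lambda^*}s_\mu=\delta_{\lambda,\mu}s_{s(\lambda)}$ for all $n\in\mathbb{N}^k$ and $\lambda,\mu\in\Lambda^{\le n}$; (KP4) $s_v=\sum_{\lambda\in v\Lambda^{\le n}}s_\lambda s_{\lambda^*}$ for $v\in\Lambda^0$, $n\in\mathbb{N}^k$. Infiniteness in rings. For a (not necessarily unital) ring $R$, $a\in M_m(R)$, $b\in M_n(R)$: $a\oplus b=\mathrm{diag}(a,b)$, and $a\precsim b$ means $a=xby$ for some $x\in M_{m,n}(R)$, $y\in M_{n,m}(R)$. A nonzero $a\in R$ is properly infinite if $a\oplus a\precsim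 a$. $R$ is purely infinite if (i) no quotient of $R$ is a division ring and (ii) for all $a\in R$, $b\in RaR$ (finite sums of elements $ras'$, $r,s'\in R$) implies $b\precsim a$. $R$ is properly purely infinite if every nonzero element is properly infinite. *)

(* Defs.v *)
From HB Require Import structures.
From mathcomp Require Import all_boot all_order all_algebra.
From mathcomp Require Import zify generic_quotient ring_quotient.
From mathcomp Require Import boolp classical_sets functions cardinality fsbigop.

Set Implicit Arguments.
Unset Strict Implicit.
Unset Printing Implicit Defensive.

Import GRing.Theory.
Local Open Scope classical_set_scope.
Local Open Scope ring_scope.

HB.mixin Record Zmodule_isNuRing R of GRing.Zmodule R := {
  numul : R -> R -> R;
  numulA : associative numul;
  numulDl : left_distributive numul +%R;
  numulDr : right_distributive numul +%R
}.

#[short(type="nuRingType")]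
HB.structure Definition NuRing := {R of Zmodule_isNuRing R & GRing.Zmodule R}.

Notation "x ** y" := (numul x y) (at level 40, left associativity) : ring_scope.

HB.mixin Record NuRing_isNuAlgebra (K : pzRingType) A
    of NuRing A & GRing.Lmodule K A := {
  nuscaleAl : forall (c : K) (x y : A), c *: (x ** y) = (c *: x) ** y;
  nuscaleAr : forall (c : K) (x y : A), c *: (x ** y) = x ** (c *: y)
}.

#[short(type="nuAlgType")]
HB.structure Definition NuAlgebra (K : pzRingType) :=
  {A of NuRing_isNuAlgebra K A & NuRing A & GRing.Lmodule K A}.

Section NuRingTheory.
Context {R : nuRingType}.
Implicit Types x y z : R.

Lemma numul0r x : 0 ** x = 0.
Proof. by apply: (addIr (0 ** x)); rewrite -numulDl !add0r. Qed.

Lemma numulr0 x : x ** 0 = 0.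
Proof. by apply: (addIr (x ** 0)); rewrite -numulDr !add0r. Qed.

Lemma numulNr x y : (- x) ** y = - (x ** y).
Proof. by apply: (addIr (x ** y)); rewrite -numulDl !addNr numul0r. Qed.

Lemma numulrN x y : x ** (- y) = - (x ** y).
Proof. by apply: (addIr (x ** y)); rewrite -numulDr !addNr numulr0. Qed.

End NuRingTheory.

Record nuideal (R : nuRingType) := NuIdeal {
  nuideal_zmod :> zmodClosed R;
  nuideal_mull : forall a x : R, x \in nuideal_zmod -> a ** x \in nuideal_zmod;
  nuideal_mulr : forall a x : R, x \in nuideal_zmod -> x ** a \in nuideal_zmod
}.

Section NuQuotient.
Variables (R : nuRingType) (I : nuideal R).
Local Open Scope quotient_scope.

Definition nuquot := Quotient.quot I.

HB.instance Definition _ := GRing.Zmodule.on nuquot.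
HB.instance Definition _ := EqQuotient.on nuquot.

Definition nuquot_mul := lift_op2 nuquot (@numul R).

Lemma sub_repr_nuquot (x : R) : x - repr (\pi_nuquot x) \in nuideal_zmod I.
Proof. by rewrite Quotient.idealrBE; apply/eqP; rewrite reprK. Qed.

Lemma pi_nuquot_mul : {morph \pi_nuquot : x y / x ** y >-> nuquot_mul x y}.
Proof.
move=> x y; unlock nuquot_mul; apply/eqP; rewrite piE Quotient.equivE.
rewrite -[_ ** _](addrNK (x ** repr (\pi_nuquot y))) -numulrN -numulDr.
rewrite -addrA -numulNr -numulDl rpredD //.
  by apply: nuideal_mull; apply: sub_repr_nuquot.
by apply: nuideal_mulr; apply: sub_repr_nuquot.
Qed.
Canonical pi_nuquot_mul_morph := PiMorph2 pi_nuquot_mul.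

Lemma nuquot_mulA : associative nuquot_mul.
Proof.
by move=> x y z; rewrite -[x]reprK -[y]reprK -[z]reprK !piE numulA.
Qed.

Lemma nuquot_mulDl : left_distributive nuquot_mul +%R.
Proof.
by move=> x y z; rewrite -[x]reprK -[y]reprK -[z]reprK !piE numulDl.
Qed.

Lemma nuquot_mulDr : right_distributive nuquot_mul +%R.
Proof.
by move=> x y z; rewrite -[x]reprK -[y]reprK -[z]reprK !piE numulDr.
Qed.

HB.instance Definition _ :=
  Zmodule_isNuRing.Build nuquot nuquot_mulA nuquot_mulDl nuquot_mulDr.

End NuQuotient.

Definition division_ring (R : nuRingType) : Prop :=
  exists e : R, [/\ e != 0,
    (forall x : R, e ** x = x /\ x ** e = x) &
    (forall x : R, x != 0 -> exists y : R, x ** y = e /\ y ** x = e)].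

Section Infiniteness.
Variable R : nuRingType.

Definition numulmx m n p (A : 'M[R]_(m, n)) (B : 'M[R]_(n, p)) : 'M[R]_(m, p) :=
  \matrix_(i, j) \sum_(l < n) A i l ** B l j.

Definition mxoplus m n (a : 'M[R]_m) (b : 'M[R]_n) : 'M[R]_(m + n) :=
  block_mx a 0 0 b.

Definition mxprecsim m n (a : 'M[R]_m) (b : 'M[R]_n) : Prop :=
  exists (x : 'M[R]_(m, n)) (y : 'M[R]_(n, m)), a = numulmx (numulmx x b) y.

Definition mx11 (a : R) : 'M[R]_1 := const_mx a.

(* R is not assumed to be unital, so [a] itself need not belong to [RaR]. *)
Definition RaR (a : R) : set R :=
  [set b | exists rs : seq (R * R), b = \sum_(p <- rs) p.1 ** a ** p.2].

Definition properly_infinite (a : R) : Prop :=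
  a != 0 /\ mxprecsim (mxoplus (mx11 a) (mx11 a)) (mx11 a).

End Infiniteness.

Definition purely_infinite (R : nuRingType) : Prop :=
  (forall I : nuideal R, ~ division_ring (nuquot I)) /\
  (forall a b : R, RaR a b -> mxprecsim (mx11 b) (mx11 a)).

Definition properly_purely_infinite (R : nuRingType) : Prop :=
  forall a : R, a != 0 -> properly_infinite a.

Notation Nk k := {ffun 'I_k -> nat}.

Section Nk.
Variable k : nat.
Implicit Types p q : Nk k.

Definition leNk p q : bool := [forall i, (p i <= q i)%N].
Definition subNk p q : Nk k := [ffun i => (p i - q i)%N].
Definition eNk (i : 'I_k) : Nk k := [ffun j => nat_of_bool (j == i)].

(* Elements of (N u {oo})^k; [None] is the infinite coordinate. *)
Definition eNk_ext := {ffun 'I_k -> option nat}.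

Definition leNk_ext p (m : eNk_ext) : bool :=
  [forall i, if m i is Some c then (p i <= c)%N else true].
Definition addNk_ext p (m : eNk_ext) : eNk_ext :=
  [ffun i => omap (addn (p i)) (m i)].

Lemma addNkE p q i : (p + q) i = (p i + q i)%N.
Proof. by rewrite ffunE. Qed.

Lemma leNkP p q : reflect (exists r, q = p + r) (leNk p q).
Proof.
apply: (iffP forallP) => [le_pq | [r ->] i]; last by rewrite !ffunE leq_addr.
by exists (subNk q p); apply/ffunP => i; rewrite !ffunE; apply/esym/subnKC.
Qed.

Lemma subNkK p q : leNk p q -> p + subNk q p = q.
Proof. by move/forallP=> le_pq; apply/ffunP => i; rewrite !ffunE; apply: subnKC. Qed.

End Nk.

Notation "p <=N q" := (leNk p q) (at level 70) : ring_scope.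
Notation "p <=E m" := (leNk_ext p m) (at level 70) : ring_scope.

(* A vertex v is identified with the morphism [idp v]. Composition is total:
   [pcomp l m] is only meaningful when [src l = rng m]. *)
Record kgraph (k : nat) := KGraph {
  vertex : countType;
  gpath :> countType;
  rng : gpath -> vertex;
  src : gpath -> vertex;
  idp : vertex -> gpath;
  pcomp : gpath -> gpath -> gpath;
  deg : gpath -> Nk k;
  rng_idp : forall v, rng (idp v) = v;
  src_idp : forall v, src (idp v) = v;
  rng_pcomp : forall l m, src l = rng m -> rng (pcomp l m) = rng l;
  src_pcomp : forall l m, src l = rng m -> src (pcomp l m) = src m;
  pcomp_idl : forall l, pcomp (idp (rng l)) l = l;
  pcomp_idr : forall l, pcomp l (idp (src l)) = l;
  pcompA : forall l m n, src l = rng m -> src m = rng n ->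
    pcomp l (pcomp m n) = pcomp (pcomp l m) n;
  deg_idp : forall v, deg (idp v) = 0;
  deg_pcomp : forall l m, src l = rng m -> deg (pcomp l m) = deg l + deg m;
  unique_factorisation : forall l (n : Nk k), n <=N deg l ->
    exists! ab : gpath * gpath,
      [/\ src ab.1 = rng ab.2, l = pcomp ab.1 ab.2,
          deg ab.1 = n & deg ab.2 = subNk (deg l) n]
}.

Arguments rng {k L} : rename.
Arguments src {k L} : rename.
Arguments idp {k L} : rename.
Arguments deg {k L} : rename.

Section KGraph.
Variables (k : nat) (L : kgraph k).
Implicit Types (v w : vertex L) (l m : L) (n p q t : Nk k) (H : set (vertex L)).

Definition vL v : set L := [set l | rng l = v].

Definition vLn v n : set L := [set l | rng l = v /\ deg l = n].

Definition Lle n : set L :=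
  [set l | deg l <=N n /\
    forall i, deg l + eNk i <=N n -> vLn (src l) (eNk i) = set0].

Definition vLw v w : set L := [set l | rng l = v /\ src l = w].

Definition row_finite : Prop := forall v n, finite_set (vLn v n).

Definition locally_convex : Prop :=
  forall (i j : 'I_k) l, i != j -> deg l = eNk i ->
    vLn (rng l) (eNk j) !=set0 -> vLn (src l) (eNk j) !=set0.

Definition is_cycle l : Prop := ~ range idp l /\ src l = rng l.

Definition reached_from v l : Prop := vLw v (src l) !=set0.

Definition vertices_above v : set (vertex L) := [set w | vLw v w !=set0].

Definition hereditary H : Prop := forall l, H (rng l) -> H (src l).

Definition saturated H : Prop :=
  forall v n, src @` (vL v `&` Lle n) `<=` H -> H v.

Lemma finite_leNk n : finite_set [set m : Nk k | m <=N n].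
Proof.
pose N := \max_i n i.
pose f (g : {ffun 'I_k -> 'I_N.+1}) : Nk k := [ffun i => val (g i)].
apply: (@sub_finite_set _ _ (range f)); last exact/finite_image/finite_finset.
move=> m /= /forallP le_mn; exists [ffun i => inord (m i)] => //.
apply/ffunP=> i; rewrite !ffunE /= inordK // ltnS.
exact: leq_trans (le_mn i) (leq_bigmax i).
Qed.

Lemma row_finite_Lle v n : row_finite -> finite_set (vL v `&` Lle n).
Proof.
move=> rf; apply: (@sub_finite_set _ _ (\bigcup_(m in [set m | m <=N n]) vLn v m)).
  by move=> l [rl [dl _]]; exists (deg l).
by apply: bigcup_finite => [|m _]; [apply: finite_leNk | apply: rf].
Qed.

(* Data of a functor on Omega_(k, m): [ppath p q] is the image of (p, q), which
   only matters for p <= q <= m. The image of the object p is the vertex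
   identified with [ppath p p]. *)
Record prepath := PrePath {
  pdeg : eNk_ext k;
  ppath : Nk k -> Nk k -> L
}.

Definition pvertex (x : prepath) (p : Nk k) : vertex L := rng (ppath x p p).

Definition prng (x : prepath) : vertex L := pvertex x 0.

(* Equality as functors: values outside Omega_(k, m) are ignored. *)
Definition prepath_eq (x y : prepath) : Prop :=
  pdeg x = pdeg y /\
  forall p q, p <=N q -> q <=E pdeg x -> ppath x p q = ppath y p q.

Record boundary_path (x : prepath) : Prop := BoundaryPath {
  bp_id : forall p, p <=E pdeg x -> ppath x p p = idp (pvertex x p);
  bp_rng : forall p q, p <=N q -> q <=E pdeg x ->
    rng (ppath x p q) = pvertex x p;
  bp_src : forall p q, p <=N q -> q <=E pdeg x ->
    src (ppath x p q) = pvertex x q;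
  bp_comp : forall p q t, p <=N q -> q <=N t -> t <=E pdeg x ->
    ppath x p t = pcomp (ppath x p q) (ppath x q t);
  bp_deg : forall p q, p <=N q -> q <=E pdeg x ->
    deg (ppath x p q) = subNk q p;
  bp_boundary : forall p i, p <=E pdeg x -> pdeg x i = Some (p i) ->
    vLn (pvertex x p) (eNk i) = set0
}.

(* l(p, q); only meaningful when p <= q <= d(l) *)
Definition segment l (p q : Nk k) : L :=
  xget l [set m | exists a b, [/\ src a = rng m, src m = rng b,
    l = pcomp a (pcomp m b), deg a = p & deg m = subNk q p]].

(* The concatenation l x. Coordinatewise subtraction is truncated, so
   d(l) + (q - d(l)) is the join of q and d(l), and (l x)(p, q) is read off
   from the finite path l x(0, q - d(l)). See [concat_prefix], [concat_shift] and
   [concat_boundary_path]. *)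
Definition concat l (x : prepath) : prepath :=
  PrePath (addNk_ext (deg l) (pdeg x))
    (fun p q => segment (pcomp l (ppath x 0 (subNk q (deg l)))) p q).

Lemma le0Nk p : (0 : Nk k) <=N p.
Proof. by apply/forallP=> i; rewrite !ffunE. Qed.

Lemma leNk_refl p : p <=N p.
Proof. by apply/forallP. Qed.

Lemma leNk_trans p q t : p <=N q -> q <=N t -> p <=N t.
Proof.
by move=> /forallP h1 /forallP h2; apply/forallP=> i; apply: leq_trans (h1 i) (h2 i).
Qed.

Lemma leNk_ext_trans p q (m : eNk_ext k) : p <=N q -> q <=E m -> p <=E m.
Proof.
move=> /forallP h1 /forallP h2; apply/forallP=> i; have := h2 i.
by case: (m i) => // c; apply: leq_trans (h1 i).
Qed.

Lemma factor_inj (a b a' b' : L) : src a = rng b -> src a' = rng b' ->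
  pcomp a b = pcomp a' b' -> deg a = deg a' -> a = a' /\ b = b'.
Proof.
move=> ab ab' E da; have dE : deg a + deg b = deg a' + deg b'.
  by rewrite -!deg_pcomp ?E.
have db : deg b = deg b'.
  move: dE; rewrite da => /ffunP dE; apply/ffunP=> i; have := dE i.
  by rewrite !ffunE => /addnI.
have le_d : deg a <=N deg (pcomp a b).
  by rewrite deg_pcomp //; apply/leNkP; exists (deg b).
have dsub : subNk (deg (pcomp a b)) (deg a) = deg b.
  by rewrite deg_pcomp //; apply/ffunP=> i; rewrite !ffunE addKn.
have [[c d] /= [_ u]] := unique_factorisation le_d.
have /u[<- <-] : [/\ src (a, b).1 = rng (a, b).2,
    pcomp a b = pcomp (a, b).1 (a, b).2, deg (a, b).1 = deg a &
    deg (a, b).2 = subNk (deg (pcomp a b)) (deg a)] by split.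
have /u[-> ->] // : [/\ src (a', b').1 = rng (a', b').2,
    pcomp a b = pcomp (a', b').1 (a', b').2, deg (a', b').1 = deg a &
    deg (a', b').2 = subNk (deg (pcomp a b)) (deg a)] by split; rewrite //= ?dsub.
Qed.

Lemma deg0_idp l : deg l = 0 -> l = idp (rng l).
Proof.
move=> dl; have [] // := @factor_inj l (idp (src l)) (idp (rng l)) l.
- by rewrite rng_idp.
- by rewrite src_idp.
- by rewrite pcomp_idl pcomp_idr.
- by rewrite deg_idp.
Qed.

Lemma segmentE a m b : src a = rng m -> src m = rng b ->
  segment (pcomp a (pcomp m b)) (deg a) (deg a + deg m) = m.
Proof.
move=> am mb; rewrite /segment; case: xgetP => [m' _ | /(_ m)]; last first.
  by case; exists a, b; split => //; apply/ffunP=> i; rewrite !ffunE addKn.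
move=> [a' [b' [am' mb' E da dm]]].
have [] := factor_inj _ _ E (esym da); rewrite ?rng_pcomp // => _.
move=> /factor_inj[] //; rewrite dm; apply/ffunP=> i; by rewrite !ffunE addKn.
Qed.

Lemma segmentP l p q : p <=N q -> q <=N deg l ->
  exists a b, [/\ src a = rng (segment l p q), src (segment l p q) = rng b,
    l = pcomp a (pcomp (segment l p q) b), deg a = p &
    deg (segment l p q) = subNk q p].
Proof.
move=> pq ql; rewrite /segment; case: xgetP => [m' _ // | no]; exfalso.
have [[c d] /= [[cd lE dc dd] _]] := unique_factorisation ql.
have pc : p <=N deg c by rewrite dc.
have [[a m] /= [[am cE da dm] _]] := unique_factorisation pc.
apply: (no m); exists a, d; split=> //; last by rewrite dm dc.
- by rewrite -cd cE src_pcomp.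
- by rewrite lE cE pcompA // -cd cE src_pcomp.
Qed.

Lemma segment_comp l p q t : p <=N q -> q <=N t -> t <=N deg l ->
  src (segment l p q) = rng (segment l q t) /\
  segment l p t = pcomp (segment l p q) (segment l q t).
Proof.
move=> pq qt tl.
have [a [b [am mb lE da dm]]] := segmentP (leNk_trans pq qt) tl.
set m := segment l p t in am mb lE dm *.
have qm : subNk q p <=N deg m.
  rewrite dm; apply/forallP=> i; rewrite !ffunE leq_sub2r //.
  exact: (forallP qt).
have [[c d] /= [[cd mE dc dd] _]] := unique_factorisation qm.
have ac : src a = rng c by rewrite am mE rng_pcomp.
have db : src d = rng b by rewrite -mb mE src_pcomp.
have cE : segment l p q = c.
  have -> : q = deg a + deg c by rewrite dc da subNkK.
  by rewrite lE mE -pcompA // -da segmentE ?rng_pcomp.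
have dE : segment l q t = d.
  have -> : t = deg (pcomp a c) + deg d.
    rewrite deg_pcomp // dd dm dc da (subNkK pq).
    apply/ffunP=> i; move/forallP/(_ i): pq; move/forallP/(_ i): qt.
    rewrite addNkE !ffunE => h1 h2; move: (t i) (q i) (p i) h1 h2 => a1 b1 c1; lia.
  have -> : q = deg (pcomp a c) by rewrite deg_pcomp // dc da subNkK.
  have -> : l = pcomp (pcomp a c) (pcomp d b).
    by rewrite lE mE -pcompA // pcompA // rng_pcomp.
  by rewrite segmentE // src_pcomp.
by rewrite cE dE.
Qed.

Lemma segment_pcomp l m p q : src l = rng m -> p <=N q -> q <=N deg l ->
  segment (pcomp l m) p q = segment l p q.
Proof.
move=> lm pq ql; have [a [b [ac cb lE da dc]]] := segmentP pq ql.
set c := segment l p q in ac cb lE dc *.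
have bm : src b = rng m by rewrite -lm lE !src_pcomp ?rng_pcomp.
have -> : pcomp l m = pcomp a (pcomp c (pcomp b m)).
  by rewrite lE -pcompA ?src_pcomp ?rng_pcomp // -pcompA.
have -> : q = deg a + deg c by rewrite dc da subNkK.
by rewrite -da segmentE ?rng_pcomp.
Qed.

Lemma locally_convex_path (i : 'I_k) l : locally_convex -> deg l i = 0%N ->
  vLn (rng l) (eNk i) !=set0 -> vLn (src l) (eNk i) !=set0.
Proof.
move=> lc; have [N] := ubnP (\sum_j deg l j)%N.
elim: N l => // N IH l lN dl ne; have [l0|] := eqVneq (deg l) 0.
  by move: ne; rewrite (deg0_idp l0) rng_idp src_idp.
move=> /eqP ne0; have [j dj] : exists j, (0 < deg l j)%N.
  apply: contrapT => no; apply: ne0; apply/ffunP=> j; rewrite ffunE.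
  by apply/eqP; rewrite -leqn0 leqNgt; apply/negP=> dj; apply: no; exists j.
have ij : j != i by apply: contraTneq dj => ->; rewrite dl.
have le_j : eNk j <=N deg l.
  by apply/forallP=> r; rewrite ffunE; case: eqP => // ->.
have [[a b] /= [[ab lE da db] _]] := unique_factorisation le_j.
have dlE r : deg l r = (eNk j r + deg b r)%N.
  by rewrite lE deg_pcomp // da addNkE.
rewrite lE src_pcomp //; apply: IH.
- rewrite -ltnS; apply: leq_ltn_trans lN.
  rewrite [leqRHS](eq_bigr _ (fun r _ => dlE r)) big_split /=.
  by rewrite [X in (_ < X + _)%N](bigD1 j) //= ffunE eqxx -addnA ltnS leq_addl.
- by have := dlE i; rewrite dl => /esym/eqP; rewrite addn_eq0 => /andP[_ /eqP].
- by rewrite -ab; apply: (lc j i) => //; move: ne; rewrite lE rng_pcomp.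
Qed.

Section Concat.
Variables (l : L) (x : prepath).
Hypotheses (bx : boundary_path x) (lx : src l = prng x).

Let w t := pcomp l (ppath x 0 t).

Lemma concat_deg_le q : q <=E pdeg (concat l x) -> subNk q (deg l) <=E pdeg x.
Proof.
move=> /forallP qe; apply/forallP=> i; have := qe i; rewrite /= !ffunE.
by case: (pdeg x i) => //= c; rewrite leq_subLR.
Qed.

Lemma concat_wE t t' : t <=N t' -> t' <=E pdeg x ->
  [/\ src (w t) = rng (ppath x t t'), w t' = pcomp (w t) (ppath x t t') &
      deg (w t) = deg l + t].
Proof.
move=> tt' t'x; have tx := leNk_ext_trans tt' t'x.
have l0 : src l = rng (ppath x 0 t) by rewrite lx (bp_rng bx) ?le0Nk.
have x0 : src (ppath x 0 t) = rng (ppath x t t').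
  by rewrite (bp_src bx) ?(bp_rng bx) ?le0Nk.
split; rewrite /w.
- by rewrite src_pcomp.
- by rewrite (bp_comp bx (le0Nk t)) // pcompA.
rewrite deg_pcomp // (bp_deg bx) ?le0Nk //; congr (_ + _).
by apply/ffunP=> i; rewrite !ffunE subn0.
Qed.

Lemma le_deg_w q : subNk q (deg l) <=E pdeg x -> q <=N deg (w (subNk q (deg l))).
Proof.
move=> qx; have [_ _ ->] := concat_wE (leNk_refl _) qx.
by apply/forallP=> i; rewrite addNkE ffunE; move: (q i) (deg l i) => a b; lia.
Qed.

Lemma concat_segment p q t : p <=N q -> q <=N t -> t <=E pdeg (concat l x) ->
  ppath (concat l x) p q = segment (w (subNk t (deg l))) p q.
Proof.
move=> pq qt /concat_deg_le tx.
have sqt : subNk q (deg l) <=N subNk t (deg l).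
  by apply/forallP=> i; rewrite !ffunE leq_sub2r // (forallP qt).
have [e -> _] := concat_wE sqt tx.
by rewrite segment_pcomp // le_deg_w //; apply: leNk_ext_trans tx.
Qed.

Lemma concat_prefix : ppath (concat l x) 0 (deg l) = l.
Proof.
have le_l : deg l <=E pdeg (concat l x).
  by apply/forallP=> i; rewrite /= !ffunE; case: (pdeg x i) => //= c; rewrite leq_addr.
rewrite /=; set m := ppath _ _ _.
have m0 : src l = rng m.
  by rewrite lx /m (bp_rng bx) ?le0Nk // concat_deg_le.
have := @segmentE (idp (rng l)) l m (src_idp _) m0.
have -> : idp (rng l) = idp (rng (pcomp l m)) by rewrite rng_pcomp.
by rewrite deg_idp add0r pcomp_idl.
Qed.

Lemma concat_shift p q : p <=N q -> q <=E pdeg x ->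
  ppath (concat l x) (deg l + p) (deg l + q) = ppath x p q.
Proof.
move=> pq qx; have [e wE dw] := concat_wE pq qx; rewrite /=.
have -> : subNk (deg l + q) (deg l) = q by apply/ffunP=> i; rewrite !ffunE addKn.
rewrite -/(w q) wE -{1}(pcomp_idr (ppath x p q)) -dw.
have -> : deg l + q = deg (w p) + deg (ppath x p q).
  by rewrite dw (bp_deg bx) // -addrA subNkK.
by rewrite segmentE ?rng_idp.
Qed.

Lemma concat_boundary_path : locally_convex -> boundary_path (concat l x).
Proof.
move=> lc; have segE p q t : p <=N q -> q <=N t -> t <=E pdeg (concat l x) ->
    exists2 z, t <=N deg z & [/\ ppath (concat l x) p q = segment z p q,
      ppath (concat l x) q t = segment z q t &
      ppath (concat l x) p t = segment z p t].
  move=> pq qt tx; exists (w (subNk t (deg l))).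
    exact/le_deg_w/concat_deg_le.
  by split; apply: concat_segment => //; rewrite ?leNk_refl // (leNk_trans pq).
have degE p q : p <=N q -> q <=E pdeg (concat l x) ->
    deg (ppath (concat l x) p q) = subNk q p.
  move=> pq qx; have [z qz [-> _ _]] := segE _ _ _ pq (leNk_refl q) qx.
  by have [a [b [? ? ? ? ->]]] := segmentP pq qz.
have idE p : p <=E pdeg (concat l x) ->
    ppath (concat l x) p p = idp (pvertex (concat l x) p).
  move=> px; apply/deg0_idp; rewrite degE ?leNk_refl //.
  by apply/ffunP=> i; rewrite !ffunE subnn.
have compE p q t : p <=N q -> q <=N t -> t <=E pdeg (concat l x) ->
    src (ppath (concat l x) p q) = rng (ppath (concat l x) q t) /\
    ppath (concat l x) p t = pcomp (ppath (concat l x) p q) (ppath (concat l x) q t).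
  move=> pq qt tx; have [z tz [-> -> ->]] := segE _ _ _ pq qt tx.
  exact: segment_comp.
have rngE p q : p <=N q -> q <=E pdeg (concat l x) ->
    rng (ppath (concat l x) p q) = pvertex (concat l x) p.
  move=> pq qx; have [<- _] := compE _ _ _ (leNk_refl p) pq qx.
  by rewrite idE ?src_idp //; apply: leNk_ext_trans qx.
have srcE p q : p <=N q -> q <=E pdeg (concat l x) ->
    src (ppath (concat l x) p q) = pvertex (concat l x) q.
  by move=> pq qx; have [-> _] := compE _ _ _ pq (leNk_refl q) qx.
split=> // [p q t pq qt tx | p i px pi]; first by have [] := compE _ _ _ pq qt tx.
have ux := concat_deg_le px; set u := subNk p (deg l) in ux.
have pp' : p <=N deg l + u.
  by apply/forallP=> j; rewrite addNkE ffunE; move: (p j) (deg l j) => a b; lia.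
have p'x : deg l + u <=E pdeg (concat l x).
  apply/forallP=> j; have := forallP ux j; rewrite /= !ffunE.
  by case: (pdeg x j) => //= c; rewrite leq_add2l.
have xi : pdeg x i = Some (u i) /\ (deg l i <= p i)%N.
  move: pi; rewrite /= !ffunE; case: (pdeg x i) => //= c [<-].
  by rewrite addKn leq_addr.
have e : pvertex (concat l x) (deg l + u) = pvertex x u.
  by rewrite /pvertex concat_shift ?leNk_refl.
have := bp_boundary bx ux xi.1; rewrite -e -(srcE _ _ pp' p'x).
rewrite -[pvertex _ p](rngE _ _ pp' p'x).
have := degE _ _ pp' p'x; move: (ppath _ _ _) => g dg nog.
apply: contrapT => /eqP/set0P h; suff [y yP] : vLn (src g) (eNk i) !=set0.
  by move: yP; rewrite nog.
apply: locally_convex_path h => //.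
by rewrite dg ffunE addNkE ffunE subnKC ?subnn //; case: xi.
Qed.

End Concat.

Definition aperiodic : Prop :=
  forall v, exists x : prepath, [/\ boundary_path x, prng x = v &
    forall a b : L, src a = v -> src b = v -> a <> b ->
      ~ prepath_eq (concat a x) (concat b x)].

End KGraph.

Section Restriction.
Variables (k : nat) (L : kgraph k) (H : set (vertex L)).
Hypothesis herH : hereditary H.

Definition rvertex := {v : vertex L | v \notin H}.
Definition rpath := {l : L | src l \notin H}.

Lemma rrng_subproof (l : rpath) : rng (val l) \notin H.
Proof. by have := valP l; apply: contra => /set_mem ?; apply/mem_set/herH. Qed.

Lemma ridp_subproof (v : rvertex) : src (idp (val v)) \notin H.
Proof. by rewrite src_idp; exact: (valP v). Qed.

Definition rrng (l : rpath) : rvertex := exist _ (rng (val l)) (rrng_subproof l).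
Definition rsrc (l : rpath) : rvertex := exist _ (src (val l)) (valP l).
Definition ridp (v : rvertex) : rpath := exist _ (idp (val v)) (ridp_subproof v).
Definition rpcomp (l m : rpath) : rpath := insubd l (pcomp (val l) (val m)).
Definition rdeg (l : rpath) : Nk k := deg (val l).

Lemma rcomposable (l m : rpath) :
  rsrc l = rrng m -> src (val l) = rng (val m).
Proof. by move/(congr1 val). Qed.

Lemma val_rpcomp (l m : rpath) :
  rsrc l = rrng m -> val (rpcomp l m) = pcomp (val l) (val m).
Proof.
move=> /rcomposable lm; rewrite val_insubd src_pcomp //.
by rewrite (valP m).
Qed.

Lemma rrng_idp v : rrng (ridp v) = v.
Proof. by apply/val_inj; rewrite /= rng_idp. Qed.

Lemma rsrc_idp v : rsrc (ridp v) = v.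
Proof. by apply/val_inj; rewrite /= src_idp. Qed.

Lemma rrng_pcomp l m : rsrc l = rrng m -> rrng (rpcomp l m) = rrng l.
Proof.
move=> lm; apply/val_inj => /=; rewrite val_rpcomp //.
by apply/rng_pcomp/rcomposable.
Qed.

Lemma rsrc_pcomp l m : rsrc l = rrng m -> rsrc (rpcomp l m) = rsrc m.
Proof.
move=> lm; apply/val_inj => /=; rewrite val_rpcomp //.
by apply/src_pcomp/rcomposable.
Qed.

Lemma rpcomp_idl l : rpcomp (ridp (rrng l)) l = l.
Proof. by apply/val_inj; rewrite val_rpcomp ?rsrc_idp //= pcomp_idl. Qed.

Lemma rpcomp_idr l : rpcomp l (ridp (rsrc l)) = l.
Proof. by apply/val_inj; rewrite val_rpcomp ?rrng_idp //= pcomp_idr. Qed.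

Lemma rpcompA l m n : rsrc l = rrng m -> rsrc m = rrng n ->
  rpcomp l (rpcomp m n) = rpcomp (rpcomp l m) n.
Proof.
move=> lm mn; apply/val_inj; rewrite !val_rpcomp ?rrng_pcomp ?rsrc_pcomp //.
by apply: pcompA; apply: rcomposable.
Qed.

Lemma rdeg_idp v : rdeg (ridp v) = 0.
Proof. exact: deg_idp. Qed.

Lemma rdeg_pcomp l m : rsrc l = rrng m -> rdeg (rpcomp l m) = rdeg l + rdeg m.
Proof. by move=> lm; rewrite /rdeg val_rpcomp // deg_pcomp //; apply: rcomposable. Qed.

Lemma runique_factorisation (l : rpath) (n : Nk k) : n <=N rdeg l ->
  exists! ab : rpath * rpath,
    [/\ rsrc ab.1 = rrng ab.2, l = rpcomp ab.1 ab.2,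
        rdeg ab.1 = n & rdeg ab.2 = subNk (rdeg l) n].
Proof.
move=> /unique_factorisation[[a b] /= [[ab lE da db] uab]].
have sb : src b \notin H by have := valP l; rewrite /= lE src_pcomp.
have sa : src a \notin H by rewrite ab; exact: (rrng_subproof (exist _ b sb)).
have abr : rsrc (exist _ a sa) = rrng (exist _ b sb) by apply/val_inj.
exists (exist _ a sa, exist _ b sb); split.
  by split=> //=; apply/val_inj; rewrite val_rpcomp.
move=> [a' b'] /= [ab' lE' da' db'].
have /uab[aE bE] : [/\ src (val a', val b').1 = rng (val a', val b').2,
    val l = pcomp (val a', val b').1 (val a', val b').2,
    deg (val a', val b').1 = n & deg (val a', val b').2 = subNk (deg (val l)) n].
  by split=> //=; [apply: rcomposable | rewrite lE' val_rpcomp].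
by congr pair; apply/val_inj.
Qed.

(* L \ L H: the paths whose source is not in H *)
Definition kgraph_remove : kgraph k :=
  KGraph rrng_idp rsrc_idp rrng_pcomp rsrc_pcomp rpcomp_idl rpcomp_idr
    rpcompA rdeg_idp rdeg_pcomp runique_factorisation.

End Restriction.

Definition strongly_aperiodic k (L : kgraph k) : Prop :=
  forall (H : set (vertex L)) (herH : hereditary H),
    saturated H -> aperiodic (kgraph_remove herH).

(* [s l] and [t l] are the images of s_l and s_(l^* ). The sum in [KP4] is over a
   finite set as soon as L is row-finite. *)
Record KP_family (K : fieldType) k (L : kgraph k) (A : nuAlgType K)
    (s t : L -> A) : Prop := KPFamily {
  KP0 : forall v, t (idp v) = s (idp v);
  KP1 : forall v w, s (idp v) ** s (idp w) = if v == w then s (idp v) else 0;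
  KP2 : forall l m, src l = rng m ->
    s l ** s m = s (pcomp l m) /\ t m ** t l = t (pcomp l m);
  KP3 : forall n l m, Lle n l -> Lle n m ->
    t l ** s m = if l == m then s (idp (src l)) else 0;
  KP4 : forall v n, s (idp v) = \sum_(l \in vL v `&` Lle n) s l ** t l
}.

Section KumjianPask.
Variables (K : fieldType) (k : nat) (L : kgraph k).

(* The universal algebra is realised as formal algebra expressions in the
   generators, two of which are identified when they agree in every K-algebra
   with a family satisfying the relations. See [KP_gen_family], [KP_universal]
   and [KP_universal_unique] for the universal property. *)
Inductive kp_term : Type :=
| TGen of L
| TGhost of L
| TZero
| TOpp of kp_term
| TAdd of kp_term & kp_term
| TScale of K & kp_term
| TMul of kp_term & kp_term.

HB.instance Definition _ := gen_eqMixin kp_term.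
HB.instance Definition _ := gen_choiceMixin kp_term.

Fixpoint kp_eval (A : nuAlgType K) (s t : L -> A) (e : kp_term) : A :=
  match e with
  | TGen l => s l
  | TGhost l => t l
  | TZero => 0
  | TOpp e1 => - kp_eval s t e1
  | TAdd e1 e2 => kp_eval s t e1 + kp_eval s t e2
  | TScale c e1 => c *: kp_eval s t e1
  | TMul e1 e2 => kp_eval s t e1 ** kp_eval s t e2
  end.

Definition kp_eq (e1 e2 : kp_term) : bool :=
  `[< forall (A : nuAlgType K) (s t : L -> A), KP_family s t ->
      kp_eval s t e1 = kp_eval s t e2 >].

Lemma kp_eqP e1 e2 :
  (forall (A : nuAlgType K) (s t : L -> A), KP_family s t ->
      kp_eval s t e1 = kp_eval s t e2) -> kp_eq e1 e2.
Proof. by move=> ?; apply/asboolP. Qed.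

Lemma kp_eq_eval e1 e2 (A : nuAlgType K) (s t : L -> A) :
  kp_eq e1 e2 -> KP_family s t -> kp_eval s t e1 = kp_eval s t e2.
Proof. by move/asboolP; apply. Qed.

Lemma kp_eq_is_equiv : equiv_class_of kp_eq.
Proof.
split=> [e | e1 e2 | e1 e2 e3].
- by apply: kp_eqP.
- by apply/asboolP/asboolP => h A s t kp; rewrite h.
- by move=> /asboolP h1 /asboolP h2; apply: kp_eqP => A s t kp; rewrite h1 ?h2.
Qed.

Canonical kp_equiv := EquivRelPack kp_eq_is_equiv.
Canonical kp_equiv_direct := defaultEncModRel kp_eq.

Definition KP := {eq_quot kp_eq}%qT.

HB.instance Definition _ := Choice.on KP.
HB.instance Definition _ := EqQuotient.on KP.

Local Open Scope quotient_scope.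

Lemma kp_piP e1 e2 :
  (forall (A : nuAlgType K) (s t : L -> A), KP_family s t ->
      kp_eval s t e1 = kp_eval s t e2) -> \pi_KP e1 = \pi_KP e2.
Proof. by move=> h; apply/eqmodP; apply: kp_eqP. Qed.

Lemma kp_repr_pi e (A : nuAlgType K) (s t : L -> A) : KP_family s t ->
  kp_eval s t (repr (\pi_KP e)) = kp_eval s t e.
Proof. by move=> kp; apply: kp_eq_eval => //; apply/eqmodP; rewrite reprK. Qed.

Definition kp_zero : KP := \pi_KP TZero.
Definition kp_opp (x : KP) : KP := \pi_KP (TOpp (repr x)).
Definition kp_add (x y : KP) : KP := \pi_KP (TAdd (repr x) (repr y)).
Definition kp_scale (c : K) (x : KP) : KP := \pi_KP (TScale c (repr x)).
Definition kp_mul (x y : KP) : KP := \pi_KP (TMul (repr x) (repr y)).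

Lemma kp_reprP (x y : KP) :
  (forall (A : nuAlgType K) (s t : L -> A), KP_family s t ->
      kp_eval s t (repr x) = kp_eval s t (repr y)) -> x = y.
Proof. by move=> h; rewrite -[x]reprK -[y]reprK; apply: kp_piP. Qed.

Ltac kp_tac := apply: kp_reprP => A s t kp; do ?rewrite kp_repr_pi //=.

Lemma kp_addA : associative kp_add.
Proof. by move=> x y z; kp_tac; rewrite addrA. Qed.
Lemma kp_addC : commutative kp_add.
Proof. by move=> x y; kp_tac; rewrite addrC. Qed.
Lemma kp_add0 : left_id kp_zero kp_add.
Proof. by move=> x; kp_tac; rewrite add0r. Qed.
Lemma kp_addN : left_inverse kp_zero kp_opp kp_add.
Proof. by move=> x; kp_tac; rewrite addNr. Qed.

HB.instance Definition _ := GRing.isZmodule.Build KP kp_addA kp_addC kp_add0 kp_addN.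

Lemma kp_scaleA a b x : kp_scale a (kp_scale b x) = kp_scale (a * b) x.
Proof. by kp_tac; rewrite scalerA. Qed.
Lemma kp_scale1 : left_id 1 kp_scale.
Proof. by move=> x; kp_tac; rewrite scale1r. Qed.
Lemma kp_scaleDr : right_distributive kp_scale +%R.
Proof. by move=> a x y; kp_tac; rewrite scalerDr. Qed.
Lemma kp_scaleDl x : {morph kp_scale^~ x : a b / a + b}.
Proof. by move=> a b; kp_tac; rewrite scalerDl. Qed.

HB.instance Definition _ :=
  GRing.Zmodule_isLmodule.Build K KP kp_scaleA kp_scale1 kp_scaleDr kp_scaleDl.

Lemma kp_mulA : associative kp_mul.
Proof. by move=> x y z; kp_tac; rewrite numulA. Qed.
Lemma kp_mulDl : left_distributive kp_mul +%R.
Proof. by move=> x y z; kp_tac; rewrite numulDl. Qed.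
Lemma kp_mulDr : right_distributive kp_mul +%R.
Proof. by move=> x y z; kp_tac; rewrite numulDr. Qed.

HB.instance Definition _ := Zmodule_isNuRing.Build KP kp_mulA kp_mulDl kp_mulDr.

Lemma kp_scaleAl (c : K) (x y : KP) : c *: (x ** y) = (c *: x) ** y.
Proof. by kp_tac; rewrite nuscaleAl. Qed.
Lemma kp_scaleAr (c : K) (x y : KP) : c *: (x ** y) = x ** (c *: y).
Proof. by kp_tac; rewrite nuscaleAr. Qed.

HB.instance Definition _ := NuRing_isNuAlgebra.Build K KP kp_scaleAl kp_scaleAr.

Definition kp_s (l : L) : KP := \pi_KP (TGen l).
Definition kp_t (l : L) : KP := \pi_KP (TGhost l).


Lemma kp_eval_gen (e : kp_term) : kp_eval kp_s kp_t e = \pi_KP e.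
Proof.
elim: e => [l|l||e IH|e1 IH1 e2 IH2|c e IH|e1 IH1 e2 IH2] //=.
- by rewrite IH; apply: kp_piP => A s t kp /=; rewrite kp_repr_pi.
- by rewrite IH1 IH2; apply: kp_piP => A s t kp /=; rewrite !kp_repr_pi.
- by rewrite IH; apply: kp_piP => A s t kp /=; rewrite kp_repr_pi.
- by rewrite IH1 IH2; apply: kp_piP => A s t kp /=; rewrite !kp_repr_pi.
Qed.

Lemma kp_sum_eval (I : Type) (r : seq I) (e : I -> kp_term)
    (A : nuAlgType K) (s t : L -> A) :
  kp_eval s t (foldr TAdd TZero (map e r)) = \sum_(i <- r) kp_eval s t (e i).
Proof. by elim: r => [|i r IH] /=; rewrite ?big_nil ?big_cons ?IH. Qed.

Definition nualg_morphism (A B : nuAlgType K) (f : A -> B) : Prop :=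
  [/\ {morph f : x y / x + y}, (forall c, {morph f : x / c *: x}) &
      {morph f : x y / x ** y}].

Definition kp_lift (A : nuAlgType K) (s t : L -> A) (x : KP) : A :=
  kp_eval s t (repr x).

Lemma KP_gen_family : row_finite L -> KP_family kp_s kp_t.
Proof.
move=> rf; split.
- by move=> v; apply: kp_piP => A s t [h _ _ _ _] /=; apply: h.
- move=> v w; transitivity (kp_eval kp_s kp_t (TMul (TGen (idp v)) (TGen (idp w)))) => //.
  rewrite kp_eval_gen; case: ifP => vw; apply: kp_piP => A s t [_ h _ _ _] /=;
  by rewrite h vw.
- move=> l m lm; split.
    transitivity (kp_eval kp_s kp_t (TMul (TGen l) (TGen m))) => //.
    by rewrite kp_eval_gen; apply: kp_piP => A s t [_ _ h _ _] /=; case: (h _ _ lm).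
  transitivity (kp_eval kp_s kp_t (TMul (TGhost m) (TGhost l))) => //.
  by rewrite kp_eval_gen; apply: kp_piP => A s t [_ _ h _ _] /=; case: (h _ _ lm).
- move=> n l m ln mn; transitivity (kp_eval kp_s kp_t (TMul (TGhost l) (TGen m))) => //.
  rewrite kp_eval_gen; case: ifP => lm; apply: kp_piP => A s t [_ _ _ h _] /=;
  by rewrite (h _ _ _ ln mn) lm.
- move=> v n; have fin := @row_finite_Lle _ L v n rf; rewrite fsbig_finite //=.
  rewrite -(kp_sum_eval _ (fun l => TMul (TGen l) (TGhost l)) kp_s kp_t) kp_eval_gen.
  apply: kp_piP => A s t [_ _ _ _ h] /=.
  by rewrite (h v n) kp_sum_eval fsbig_finite.
Qed.

Lemma KP_universal (A : nuAlgType K) (s t : L -> A) : KP_family s t ->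
  [/\ nualg_morphism (kp_lift s t), (forall l, kp_lift s t (kp_s l) = s l) &
      (forall l, kp_lift s t (kp_t l) = t l)].
Proof.
by move=> kp; split=> [|l|l]; [split=> [x y|c x|x y]|..]; apply: kp_repr_pi kp.
Qed.

Lemma KP_universal_unique (A : nuAlgType K) (f g : KP -> A) :
  nualg_morphism f -> nualg_morphism g ->
  (forall l, f (kp_s l) = g (kp_s l)) -> (forall l, f (kp_t l) = g (kp_t l)) ->
  f =1 g.
Proof.
move=> [fD fZ fM] [gD gZ gM] fgs fgt x.
have f0 : f 0 = 0 by apply: (addIr (f 0)); rewrite -fD !add0r.
have g0 : g 0 = 0 by apply: (addIr (g 0)); rewrite -gD !add0r.
have fN y : f (- y) = - f y by rewrite -scaleN1r fZ scaleN1r.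
have gN y : g (- y) = - g y by rewrite -scaleN1r gZ scaleN1r.
rewrite -[x]reprK -kp_eval_gen; elim: (repr x) => //=.
- by rewrite f0 g0.
- by move=> e IH; rewrite fN gN IH.
- by move=> e1 IH1 e2 IH2; rewrite fD gD IH1 IH2.
- by move=> c e IH; rewrite fZ gZ IH.
- by move=> e1 IH1 e2 IH2; rewrite fM gM IH1 IH2.
Qed.

End KumjianPask.

Arguments KP K {k} L.

(* Main.v *)
(** Call an element b absorbed by a when b (+) a is below a. The elements absorbed
    by a form an ideal, a is properly infinite iff it absorbs itself, and an
    idempotent p below a with p (+) p below p is absorbed by a. This gives
    (3) => (4) in any ring.

    For (1) => (3), strong aperiodicity and the finiteness hypothesis first show
    that every vertex projection is properly infinite. Given a nonzero a that does
    not absorb itself, let H be the saturated hereditary set of the vertices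
    absorbed by a. Multiplying a on the right by some s_l outside the ideal of
    absorbed elements turns it into a linear combination of paths with a common
    source not in H, and aperiodicity of the complement of H compresses that
    combination to a vertex projection outside H. That projection lies below a and
    is properly infinite, hence absorbed, which is absurd.

    For (4) => (1), a vertex v with v L = {v} has corner s_v KP s_v = K s_v, with
    s_v nonzero since KP acts on the functions on the paths ending at v. If v is
    the only such path, s_v is central and K is a quotient of KP; otherwise the
    ideal of s_v contains an element of rank two, which is not below s_v. *)

From HB Require Import structures.
From mathcomp Require Import all_boot all_order all_algebra.
From mathcomp Require Import finmap zify generic_quotient ring_quotient.
From mathcomp Require Import boolp classical_sets functions cardinality fsbigop.
Require Import Defs.

Set Implicit Arguments.
Unset Strict Implicit.
Unset Printing Implicit Defensive.

Import GRing.Theory.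
Local Open Scope classical_set_scope.
Local Open Scope ring_scope.

(** * Absorption and proper infiniteness *)

Lemma numul_sumr (R : nuRingType) (I : Type) (r : seq I) (F : I -> R) (z : R) :
  z ** (\sum_(i <- r) F i) = \sum_(i <- r) z ** F i.
Proof.
by elim: r => [|i r IH]; rewrite ?big_nil ?numulr0 // !big_cons numulDr IH.
Qed.

Lemma numul_suml (R : nuRingType) (I : Type) (r : seq I) (F : I -> R) (z : R) :
  (\sum_(i <- r) F i) ** z = \sum_(i <- r) F i ** z.
Proof.
by elim: r => [|i r IH]; rewrite ?big_nil ?numul0r // !big_cons numulDl IH.
Qed.

Section ProperInfiniteness.
Variable R : nuRingType.
Implicit Types a b c p u x y : R.

(** The four entries of b (+) c = x a y, with x a column and y a row of length two. *)
Definition oplus_precsim b c a : Prop := exists x1 x2 y1 y2,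
  [/\ x1 ** a ** y1 = b, x1 ** a ** y2 = 0, x2 ** a ** y1 = 0 &
      x2 ** a ** y2 = c].

Lemma mxprecsim11 b a :
  mxprecsim (mx11 b) (mx11 a) <-> exists x y, b = x ** a ** y.
Proof.
split=> [[x [y /matrixP E]]|[x [y E]]].
  exists (x 0 0), (y 0 0); have := E 0 0.
  by rewrite !mxE !big_ord1 !mxE big_ord1 !mxE.
exists (mx11 x), (mx11 y); apply/matrixP => i j.
by rewrite !mxE !big_ord1 !mxE big_ord1 !mxE.
Qed.

Lemma mxprecsim_oplus b c a :
  mxprecsim (mxoplus (mx11 b) (mx11 c)) (mx11 a) <-> oplus_precsim b c a.
Proof.
pose l : 'I_(1 + 1) := lshift 1 ord0; pose r : 'I_(1 + 1) := rshift 1 ord0.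
split=> [[x [y /matrixP E]]|[x1 [x2 [y1 [y2 [E11 E12 E21 E22]]]]]].
  exists (x l 0), (x r 0), (y 0 l), (y 0 r); split.
  - have := E l l.
    by rewrite block_mxEul !mxE !big_ord1 !mxE big_ord1 !mxE => ->.
  - have := E l r.
    by rewrite block_mxEur !mxE !big_ord1 !mxE big_ord1 !mxE => ->.
  - have := E r l.
    by rewrite block_mxEdl !mxE !big_ord1 !mxE big_ord1 !mxE => ->.
  - have := E r r.
    by rewrite block_mxEdr !mxE !big_ord1 !mxE big_ord1 !mxE => ->.
exists (col_mx (mx11 x1) (mx11 x2)), (row_mx (mx11 y1) (mx11 y2)).
apply/matrixP => i j; case: (split_ordP i) => i' ->; case: (split_ordP j) => j' ->.
- rewrite block_mxEul [RHS]mxE big_ord1 [X in _ = X ** _]mxE big_ord1.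
  by rewrite col_mxEu row_mxEl !mxE.
- rewrite block_mxEur [RHS]mxE big_ord1 [X in _ = X ** _]mxE big_ord1.
  by rewrite col_mxEu row_mxEr !mxE.
- rewrite block_mxEdl [RHS]mxE big_ord1 [X in _ = X ** _]mxE big_ord1.
  by rewrite col_mxEd row_mxEl !mxE.
- rewrite block_mxEdr [RHS]mxE big_ord1 [X in _ = X ** _]mxE big_ord1.
  by rewrite col_mxEd row_mxEr !mxE.
Qed.

Lemma properly_infiniteE a :
  properly_infinite a <-> a != 0 /\ oplus_precsim a a a.
Proof. by split=> -[a0 /mxprecsim_oplus]. Qed.

Definition absorbed a : set R := [set b | oplus_precsim b a a].

(** Without a unit, even 0 (+) a below [a] needs a factorisation of [a] through itself; local units
    provide it. *)
Lemma absorbed0 a x y : a = x ** a ** y -> absorbed a 0.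
Proof.
by move=> E; exists 0, x, 0, y; split; rewrite ?numul0r ?numulr0 // -E.
Qed.

Lemma absorbed_mull a b x : absorbed a b -> absorbed a (x ** b).
Proof.
move=> [x1 [x2 [y1 [y2 [E11 E12 E21 E22]]]]].
exists (x ** x1), x2, y1, y2; split=> //.
- by rewrite -E11 !numulA.
- by rewrite -!numulA [x1 ** _]numulA E12 numulr0.
Qed.

Lemma absorbed_mulr a b y : absorbed a b -> absorbed a (b ** y).
Proof.
move=> [x1 [x2 [y1 [y2 [E11 E12 E21 E22]]]]].
exists x1, x2, (y1 ** y), y2; split=> //.
- by rewrite -E11 !numulA.
- by rewrite numulA E21 numul0r.
Qed.

(** The copy of [a] left beside [c] is used again to hold [b] and a new copy of [a], so c (+) b (+)
    a is below [a]; adding the first two rows and columns merges [c] and [b] into their sum. *)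
Lemma absorbedD a b c : absorbed a b -> absorbed a c -> absorbed a (b + c).
Proof.
move=> [x1 [x2 [y1 [y2 [E11 E12 E21 E22]]]]].
move=> [z1 [z2 [t1 [t2 [F11 F12 F21 F22]]]]].
have G r s : (r ** z2) ** a ** (t2 ** s) = r ** a ** s.
  by rewrite -{2}F22 !numulA.
have G1 s : z1 ** a ** (t2 ** s) = 0 by rewrite numulA F12 numul0r.
have G2 r : (r ** z2) ** a ** t1 = 0.
  by rewrite -!numulA [z2 ** _]numulA F21 numulr0.
exists (x1 ** z2 + z1), (x2 ** z2), (t2 ** y1 + t1), (t2 ** y2); split.
- by rewrite !numulDl !numulDr G G1 G2 F11 E11 add0r addr0.
- by rewrite !numulDl G G1 E12 addr0.
- by rewrite !numulDr G G2 E21 addr0.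
- by rewrite G.
Qed.

Lemma absorbed_sum a (I : eqType) (r : seq I) (F : I -> R) :
  absorbed a 0 -> (forall i, i \in r -> absorbed a (F i)) ->
  absorbed a (\sum_(i <- r) F i).
Proof.
move=> a0 aF; rewrite big_seq; elim/big_ind: _ => // x y; exact: absorbedD.
Qed.

Lemma absorbed_precsim a b : absorbed a b -> exists x y, b = x ** a ** y.
Proof. by move=> [x1 [x2 [y1 [y2 [<- _ _ _]]]]]; exists x1, y1. Qed.

(* With e = a y x and f = y x a, the element [a] is block diagonal, equal to
   e a f (+) (1 - e) a (1 - f), and its first block is equivalent to [p]; since
   [p] absorbs [p], so does [a]. A local unit [u] of [a] replaces 1. *)
Lemma absorbed_idempotent a p u : p ** p = p -> oplus_precsim p p p ->
  u ** a = a -> a ** u = a -> (exists x y, p = x ** a ** y) -> absorbed a p.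
Proof.
move=> pp [x1 [x2 [y1 [y2 [E11 E12 E21 E22]]]]] ua au [x0 [y0 pE]].
pose x := p ** x0; pose y := y0 ** p; pose r := x ** a; pose c := a ** y.
have ry : r ** y = p.
  have -> : r ** y = p ** (x0 ** a ** y0) ** p by rewrite /r /x /y !numulA.
  by rewrite -pE !pp.
have pr : p ** r = r by rewrite /r /x !numulA pp.
have cp : c ** p = c by rewrite /c /y -!numulA pp.
have ru : r ** u = r by rewrite /r -numulA au.
have X1a : (x1 ** x) ** a = x1 ** r by rewrite /r numulA.
have X2a : (c ** x2 ** x + (u - c ** x)) ** a = c ** x2 ** r + (a - c ** r).
  by rewrite !numulDl numulNr ua /r !numulA.
have zy : (a - c ** r) ** y = 0 by rewrite numulDl numulNr -numulA ry cp addrN.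
clearbody r c x y.
exists (x1 ** x), (c ** x2 ** x + (u - c ** x)), (y ** y1),
  (y ** y2 ** r + (u - y ** r)); rewrite X1a X2a; split.
- by rewrite numulA -[x1 ** r ** y]numulA ry.
- rewrite !numulDr numulrN !numulA -[x1 ** r ** y]numulA ry E12 numul0r add0r.
  by rewrite -!numulA ru pr addrN.
- rewrite numulA numulDl zy addr0 -[c ** x2 ** r ** y]numulA ry -!numulA.
  by rewrite [x2 ** _]numulA E21 numulr0.
- have zu : (a - c ** r) ** u = a - c ** r by rewrite numulDl numulNr au -numulA ru.
  rewrite numulDl !numulDr !numulrN !numulA zy !numul0r zu oppr0 addr0 add0r.
  rewrite -[c ** x2 ** r ** y]numulA ry -[c ** x2 ** r ** u]numulA ru.
  rewrite -[c ** x2 ** p ** r]numulA pr addrN addr0.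
  by rewrite -[c ** x2 ** p]numulA -[c ** _ ** y2]numulA E22 cp addrC addrNK.
Qed.

(** The ideal of elements absorbed by [a] contains [a], hence [RaR], and absorbed elements are below
    [a]. *)
Lemma properly_infinite_RaR a b : properly_infinite a -> RaR a b ->
  mxprecsim (mx11 b) (mx11 a).
Proof.
move=> /properly_infiniteE[_ aa] [rs ->]; apply/mxprecsim11/absorbed_precsim.
have [x [y aE]] := absorbed_precsim aa.
apply: absorbed_sum; first exact: absorbed0 aE.
by move=> i _; apply/absorbed_mulr/absorbed_mull.
Qed.

End ProperInfiniteness.

(** Proper infiniteness of a lift of 1 puts 1 (+) 1 below 1 in the quotient. A division ring forbids
    this: [x1] is invertible, so x1 y2 = 0 forces y2 = 0, against x2 y2 = 1. *)
Lemma properly_purely_infiniteP (R : nuRingType) :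
  properly_purely_infinite R -> purely_infinite R.
Proof.
move=> piR; split=> [I|a b]; last first.
  have [-> [rs ->]|a0] := eqVneq a 0; last exact/properly_infinite_RaR/piR.
  apply/mxprecsim11; exists 0, 0.
  by rewrite big1 ?numulr0 // => p _; rewrite numulr0 numul0r.
move=> [e [e0 eU eV]].
pose q : R -> nuquot I := \pi_(nuquot I)%qT.
have qM : {morph q : x y / x ** y} by exact: (@pi_nuquot_mul _ I).
have q0 : q 0 = 0 by exact: (raddf0 (\pi_(Quotient.quot I)%qT)).
have qr : q (repr e) = e by apply: reprK.
have /piR/properly_infiniteE[_ [x1 [x2 [y1 [y2 [E11 E12 _ E22]]]]]] : repr e != 0.
  by apply: contraNneq e0 => r0; rewrite -qr r0 q0.
have {}E11 : q x1 ** q y1 = e by rewrite -qr -E11 !qM qr (eU _).2.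
have {}E12 : q x1 ** q y2 = 0 by rewrite -q0 -E12 !qM qr (eU _).2.
have {}E22 : q x2 ** q y2 = e by rewrite -qr -E22 !qM qr (eU _).2.
have x0 : q x1 != 0 by apply: contraNneq e0 => z; rewrite -E11 z numul0r.
have [z [_ zE]] := eV _ x0.
by case/eqP: e0; rewrite -E22 -((eU (q y2)).1) -zE -numulA E12 !numulr0.
Qed.

(** * Paths in k-graphs *)

Section Paths.
Variables (k : nat) (L : kgraph k).
Implicit Types (v w : vertex L) (l m a b : L) (n p q N : Nk k).

Definition joinNk p q : Nk k := [ffun i => maxn (p i) (q i)].

Lemma leNk_joinl p q : p <=N joinNk p q.
Proof. by apply/forallP => i; rewrite ffunE leq_maxl. Qed.

Lemma leNk_joinr p q : q <=N joinNk p q.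
Proof. by apply/forallP => i; rewrite ffunE leq_maxr. Qed.

Lemma factor_at l n : n <=N deg l -> exists a b,
  [/\ src a = rng b, l = pcomp a b, deg a = n &
    forall i, deg b i = (deg l i - n i)%N].
Proof.
move=> /unique_factorisation[[a b] /= [[ab lE da db] _]].
by exists a, b; split=> // i; rewrite db ffunE.
Qed.

Lemma vLn_rng l (i : 'I_k) : deg l i != 0%N -> vLn (rng l) (eNk i) !=set0.
Proof.
move=> di; have /factor_at[a [b [ab lE da _]]] : eNk i <=N deg l.
  by apply/forallP=> j; rewrite ffunE; case: eqP => // ->; rewrite lt0n.
by exists a; split; rewrite // lE rng_pcomp.
Qed.

Definition reach v w : Prop := vLw v w !=set0.

Lemma reach_refl v : reach v v.
Proof. by exists (idp v); split; rewrite ?rng_idp ?src_idp. Qed.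

Lemma reach_path l : reach (rng l) (src l).
Proof. by exists l. Qed.

Lemma reach_trans w v u : reach v w -> reach w u -> reach v u.
Proof.
move=> [a [ra sa]] [b [rb sb]]; have ab : src a = rng b by rewrite sa rb.
by exists (pcomp a b); split; rewrite ?rng_pcomp ?src_pcomp.
Qed.

(** Induction on the number of vertices seen from [v]: a vertex [u] of [P] seen from [v] that does
    not see [v] back sees strictly fewer. *)
Lemma bottom_vertex (P : set (vertex L)) v :
  (forall v, finite_set (vertices_above v)) -> P v ->
  exists w, [/\ reach v w, P w & forall u, reach w u -> P u -> reach u w].
Proof.
move=> fin; have [N] := ubnP #|` fset_set (vertices_above v)|.
elim: N v => // N IH v vN Pv.
have [back|/existsNP[u /not_implyP[vu /not_implyP[Pu nuv]]]] :=
  EM (forall u, reach v u -> P u -> reach u v).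
  by exists v; split=> //; apply: reach_refl.
have [||w [uw Pw wP]] // := IH u.
  rewrite -ltnS; apply: leq_trans vN; rewrite ltnS.
  apply/fproper_ltn_card; rewrite fproperE; apply/andP; split.
    by rewrite -fset_set_sub // => z; apply: reach_trans.
  by apply/negP; rewrite -fset_set_sub // => /(_ v (reach_refl v)).
by exists w; split=> //; apply: reach_trans uw.
Qed.

Lemma cycle_reaches l m : src l = rng m -> src m = rng l -> deg l <> 0 ->
  is_cycle (pcomp l m).
Proof.
move=> lm ml dl; split; last by rewrite src_pcomp // rng_pcomp.
move=> [v _ E]; apply: dl; apply/ffunP => i; have := deg_pcomp lm.
rewrite -E deg_idp => /ffunP/(_ i); rewrite !(addNkE, ffunE) => /esym/eqP.
by rewrite addn_eq0 => /andP[/eqP].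
Qed.

Lemma nontrivial_path v : vL v <> [set idp v] -> exists2 l, rng l = v & deg l <> 0.
Proof.
move=> ne; apply: contrapT => no; apply: ne; apply/seteqP; split=> l /=.
  move=> rl; rewrite -rl; apply: deg0_idp; apply: contrapT => dl.
  by apply: no; exists l.
by move=> ->; rewrite /vL /= rng_idp.
Qed.

Lemma Lle_idp v n : (forall i, vLn v (eNk i) = set0) -> Lle n (idp v).
Proof. by move=> sv; split=> [|i _]; rewrite ?deg_idp ?le0Nk ?src_idp. Qed.

Lemma Lle_source l n : (forall i, vLn (src l) (eNk i) = set0) ->
  deg l <=N n -> Lle n l.
Proof. by move=> sv dl; split. Qed.

Lemma Lle_deg l : Lle (deg l) l.
Proof.
split; first exact: leNk_refl.
by move=> i /forallP/(_ i); rewrite !(addNkE, ffunE) eqxx addn1 ltnn.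
Qed.

Lemma addNk_mono n l a : deg l <=N n -> deg a <=N subNk n (deg l) ->
  src l = rng a -> deg (pcomp l a) <=N n.
Proof.
move=> /forallP h1 /forallP h2 la; rewrite deg_pcomp //; apply/forallP=> i.
by have := h1 i; have := h2 i; rewrite !(addNkE, ffunE); lia.
Qed.

Lemma Lle_pcomp n l a : deg l <=N n -> Lle (subNk n (deg l)) a -> src l = rng a ->
  Lle n (pcomp l a).
Proof.
move=> dl [da aP] la; split; first exact: addNk_mono.
move=> i; rewrite deg_pcomp // src_pcomp // => /forallP h; apply: aP.
by apply/forallP=> j; have := h j; rewrite !(addNkE, ffunE); lia.
Qed.

Lemma Lle_pcompl n l a : Lle n a -> src l = rng a -> Lle (deg l + n) (pcomp l a).
Proof.
move=> [/forallP da aP] la; split.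
  rewrite deg_pcomp //; apply/forallP=> i; have := da i.
  by rewrite !(addNkE, ffunE); lia.
move=> i; rewrite deg_pcomp // src_pcomp // => /forallP h; apply: aP.
by apply/forallP=> j; have := h j; rewrite !(addNkE, ffunE); lia.
Qed.

(** If [l] falls short of [n] in direction [i], no edge of degree e_i can be appended to it, so [a]
    has degree 0 there. The degree of a prefix in [Lle n] is thus fixed by the whole path. *)
Lemma Lle_prefix_deg n l a (i : 'I_k) : Lle n l -> src l = rng a ->
  deg l i = minn (n i) (deg (pcomp l a) i).
Proof.
move=> [/forallP dl lP] la; rewrite deg_pcomp // addNkE.
have := dl i; have [->|ai] := eqVneq (deg a i) 0%N; first by lia.
have [lt|ge] := ltnP (deg l i) (n i); last by lia.
have := vLn_rng ai; rewrite -la lP ?set0P; first by case.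
apply/forallP=> j; have := dl j; rewrite !(addNkE, ffunE).
by case: eqP => [->|_] /=; lia.
Qed.

Lemma Lle_prefix_inj n l m a b : Lle n l -> Lle n m -> src l = rng a ->
  src m = rng b -> pcomp l a = pcomp m b -> l = m.
Proof.
move=> ln mn la mb E; case: (factor_inj la mb E) => //.
by apply/ffunP=> i; rewrite (Lle_prefix_deg i ln la) (Lle_prefix_deg i mn mb) E.
Qed.

(** The prefix of degree min(n, d(l)) works: where [n] exceeds d(l), the rest [b] has degree 0, so
    local convexity would carry an edge at the source of [a] to the source of [l], where there is
    none. *)
Lemma Lle_prefix n N l : locally_convex L -> n <=N N -> Lle N l ->
  exists a b, [/\ src a = rng b, l = pcomp a b & Lle n a].
Proof.
move=> lc /forallP nN [/forallP dl lP].
pose p : Nk k := [ffun i => minn (n i) (deg l i)].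
have /factor_at[a [b [ab lE da db]]] : p <=N deg l.
  by apply/forallP=> i; rewrite ffunE geq_minr.
exists a, b; split=> //; split.
  by apply/forallP=> i; rewrite da ffunE geq_minl.
move=> i /forallP h; apply/eqP; apply/negPn/negP => /eqP/eqP/set0P ne.
have li : (deg l i < n i)%N.
  by have := h i; rewrite !(addNkE, ffunE) da ffunE eqxx; lia.
suff [y] : vLn (src b) (eNk i) !=set0.
  rewrite -(src_pcomp ab) -lE lP; first by case.
  apply/forallP=> j.
  have := dl j; have := nN j; rewrite !(addNkE, ffunE); case: eqP => [->|_]; lia.
apply: locally_convex_path; rewrite -?ab //.
by rewrite db /p ffunE; lia.
Qed.

Definition disjoint_paths l m : Prop := forall a b,
  src l = rng a -> src m = rng b -> pcomp l a <> pcomp m b.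

Lemma disjoint_paths_pcomp l m a b : src l = rng a -> src m = rng b ->
  disjoint_paths l m -> disjoint_paths (pcomp l a) (pcomp m b).
Proof.
move=> la mb d c c'; rewrite !src_pcomp // => ac bc.
by rewrite -!pcompA //; apply: d; rewrite rng_pcomp.
Qed.

(** The largest hereditary subset of [S]. It turns a saturated set into one to which strong
    aperiodicity applies. *)
Definition core (S : set (vertex L)) : set (vertex L) :=
  [set v | forall u, reach v u -> S u].

Lemma core_hereditary S : hereditary (core S).
Proof. by move=> l hl u /(reach_trans (reach_path l)) /hl. Qed.

(** For [l] with range [v] and source [w], extend [l] by paths [a] up to the join of d(l) and [n].
    Each l a has a prefix in [Lle n], whose source is in the core and sees the source of [a];
    saturation of [S] at [w] then applies. *)
Lemma core_saturated S : locally_convex L -> saturated S -> saturated (core S).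
Proof.
move=> lc sS v n sub w [l [rl <-]]; rewrite -{}rl in sub.
apply: (sS _ (subNk (joinNk (deg l) n) (deg l))) => _ [a [ra aN] <-].
have la : src l = rng a by [].
have [||b [c [bc E bn]]] := @Lle_prefix n (joinNk (deg l) n) (pcomp l a) lc.
- exact: leNk_joinr.
- by apply: Lle_pcomp => //; apply: leNk_joinl.
have /(_ (src a)) : core S (src b).
  apply: sub; exists b => //; split=> //.
  by rewrite /vL /= -(rng_pcomp bc) -E rng_pcomp.
by apply; rewrite -(src_pcomp la) E src_pcomp // bc; apply: reach_path.
Qed.

(** Since [v] has an edge of degree e_i, [Lle] at e_i contains no trivial path at [v]; if all its
    edges there led into [H], saturation would put [v] in [H]. *)
Lemma saturated_edge (H : set (vertex L)) v i : saturated H -> ~ H v ->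
  vLn v (eNk i) !=set0 -> exists2 l, vLn v (eNk i) l & ~ H (src l).
Proof.
move=> sat Hv [m [rm dm]]; apply: contrapT => no; apply: Hv; apply: (sat _ (eNk i)).
move=> _ [l [rl [dl lP]] <-]; apply: contrapT => Hl; apply: no.
exists l => //; split=> //.
have [d0|/eqP d1] := eqVneq (deg l i) 0%N.
  have l0 : deg l = 0.
    apply/ffunP=> j; have := forallP dl j; rewrite !(addNkE, ffunE).
    by case: eqP => [->|_]; rewrite ?d0 // leqn0 => /eqP.
  have := lP i; rewrite l0 add0r => /(_ (leNk_refl _)).
  have : src l = v by rewrite (deg0_idp l0) src_idp.
  by move=> -> /seteqP[/(_ m)] /(_ (conj rm dm)).
apply/ffunP=> j; have := forallP dl j; rewrite !(addNkE, ffunE).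
by case: eqP => [->|_] /=; lia.
Qed.

End Paths.

(** * Separating paths *)

Section Separation.
Variables (k : nat) (L : kgraph k) (H : set (vertex L)).
Hypotheses (herH : hereditary H) (satH : saturated H).
Implicit Types (v w : vertex L) (n p q : Nk k).

Local Notation M := (kgraph_remove herH).

Lemma leNk_ext_join (m : eNk_ext k) p q :
  p <=E m -> q <=E m -> joinNk p q <=E m.
Proof.
move=> /forallP h1 /forallP h2; apply/forallP => i; have := h1 i; have := h2 i.
by case: (m i) => // c; rewrite ffunE geq_max => -> ->.
Qed.

Lemma val_pcomp_remove (a b : M) : src a = rng b ->
  val (pcomp a b) = pcomp (val a) (val b).
Proof. by move=> ab; apply: val_rpcomp. Qed.

Lemma composable_remove (a b : M) : src a = rng b -> src (val a) = rng (val b).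
Proof. by move=> ab; apply: rcomposable. Qed.

(** Removing a saturated set never removes all edges of a given degree at a surviving vertex, so
    where a boundary path of [M] ends in direction [i], [L] has no such edge either. *)
Lemma remove_no_edge (v : vertex M) i : vLn v (eNk i) = set0 ->
  vLn (val v) (eNk i) = set0.
Proof.
move=> v0; apply/eqP; apply/negPn/negP => /set0P.
have nHv : ~ H (val v) by move=> /mem_set Hv; have := valP v; rewrite Hv.
move=> /(saturated_edge satH nHv)[l [rl dl] nHl].
have Pl : src l \notin H by apply/negP => /set_mem.
have : vLn v (eNk i) (exist _ l Pl : M) by split=> //; apply/val_inj.
by rewrite v0.
Qed.

(** A common extension, even one in [L] leaving [M], would have a single segment from [p] to [q], by
    unique factorisation. *)
Lemma segment_disjoint (c d : M) p q : p <=N q -> q <=N deg c -> q <=N deg d ->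
  segment c p q <> segment d p q -> disjoint_paths (val c) (val d).
Proof.
move=> pq qc qd ne a b ca db E; apply: ne.
have [c1 [c2 [h1 h2 cE d1 d2]]] := segmentP pq qc.
have [b1 [b2 [g1 g2 dE e1 e2]]] := segmentP pq qd.
move: (segment c p q) (segment d p q) h1 h2 cE d2 g1 g2 dE e2 =>
  c0 d0 h1 h2 cE d2 g1 g2 dE e2.
have c02 : rng (pcomp c0 c2) = rng c0 by apply: rng_pcomp.
have d02 : rng (pcomp d0 b2) = rng d0 by apply: rng_pcomp.
have vcE : val c = pcomp (val c1) (pcomp (val c0) (val c2)).
  by rewrite {1}cE !val_pcomp_remove // c02.
have vdE : val d = pcomp (val b1) (pcomp (val d0) (val b2)).
  by rewrite {1}dE !val_pcomp_remove // d02.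
move: h1 h2 g1 g2 => /composable_remove h1 /composable_remove h2
  /composable_remove g1 /composable_remove g2.
move: ca db E; rewrite vcE vdE !src_pcomp ?rng_pcomp // => ca db.
rewrite -!pcompA ?rng_pcomp ?src_pcomp ?rng_pcomp //.
have dd1 : deg (val c1) = deg (val b1) by rewrite -[LHS]/(deg c1) d1 -e1.
have dd2 : deg (val c0) = deg (val d0) by rewrite -[LHS]/(deg c0) d2 -e2.
move=> /factor_inj[]; rewrite ?rng_pcomp // => _.
by move=> /factor_inj[]; rewrite ?rng_pcomp // => /val_inj.
Qed.

(* If the degrees of [a x] and [b x] differ in direction [i], then [x] is finite in
   that direction; past its end no edge of degree [e_i] is left, so the difference
   can never be made up. *)
Lemma concat_disjoint (x : prepath M) (a b : M) : boundary_path x ->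
  src a = prng x -> src b = prng x -> ~ prepath_eq (concat a x) (concat b x) ->
  exists2 n, n <=E pdeg x &
    disjoint_paths (pcomp (val a) (val (ppath x 0 n)))
                   (pcomp (val b) (val (ppath x 0 n))).
Proof.
move=> bx ax bx' ne.
have x0 n : n <=E pdeg x -> rng (ppath x 0 n) = prng x.
  by move=> nx; apply: bp_rng => //; apply: le0Nk.
have [dE|dne] := pselect (pdeg (concat a x) = pdeg (concat b x)).
  have [p /existsNP[q /not_implyP[pq /not_implyP[qa nE]]]] :
      exists p, ~ forall q, p <=N q -> q <=E pdeg (concat a x) ->
        ppath (concat a x) p q = ppath (concat b x) p q.
    by apply/existsNP => E; apply: ne; split.
  have qb : q <=E pdeg (concat b x) by rewrite -dE.
  have qax := concat_deg_le qa; have qbx := concat_deg_le qb.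
  (* Long enough for the segments up to [q] of both a x and b x to be read off from finite paths. *)
  pose n := joinNk (subNk q (deg a)) (subNk q (deg b)).
  have nx : n <=E pdeg x by apply: leNk_ext_join.
  exists n => //; rewrite -!val_pcomp_remove ?x0 //.
  have segE c : src c = prng x -> subNk q (deg c) <=E pdeg x ->
      subNk q (deg c) <=N n -> q <=N deg (pcomp c (ppath x 0 n)) /\
      ppath (concat c x) p q = segment (pcomp c (ppath x 0 n)) p q.
    move=> cx qcx qcn; have [e E d] := concat_wE bx cx qcn nx.
    have le := le_deg_w bx cx qcx; rewrite E segment_pcomp //; split=> //.
    by rewrite deg_pcomp //; apply: leNk_trans le _; apply/leNkP; eexists.
  have [qda Ea] := segE a ax qax (leNk_joinl _ _).
  have [qdb Eb] := segE b bx' qbx (leNk_joinr _ _).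
  by apply: (segment_disjoint pq) => //; rewrite -Ea -Eb.
have [i [c [xi abi]]] : exists i c, pdeg x i = Some c /\ deg a i <> deg b i.
  apply: contrapT => no; apply: dne; apply/ffunP => i; rewrite /= !ffunE.
  case E: (pdeg x i) => [c|] //=; congr Some; congr addn.
  by apply: contrapT => abi; apply: no; exists i, c.
pose n : Nk k := [ffun j => if j == i then c else 0%N].
have nx : n <=E pdeg x.
  apply/forallP => j; rewrite ffunE; case: eqP => [->|_]; first by rewrite xi.
  by case: (pdeg x j).
exists n => //; have xn := x0 _ nx.
have noi : vLn (src (val (ppath x 0 n))) (eNk i) = set0.
  rewrite -[src (val _)]/(val (src (ppath x 0 n))).
  apply: remove_no_edge; rewrite (bp_src bx) ?le0Nk //.
  by apply: (bp_boundary bx nx); rewrite xi ffunE eqxx.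
have az c1 : src (val (ppath x 0 n)) = rng c1 -> deg c1 i = 0%N.
  move=> e; apply/eqP/negPn/negP => /vLn_rng; rewrite -e noi; by case.
have axn : src (val a) = rng (val (ppath x 0 n)).
  by apply: composable_remove; rewrite ax xn.
have bxn : src (val b) = rng (val (ppath x 0 n)).
  by apply: composable_remove; rewrite bx' xn.
move=> c1 c2; rewrite !src_pcomp // => e1 e2 E; apply: abi.
have := congr1 (fun l => deg l i) E; rewrite !deg_pcomp ?src_pcomp //.
by rewrite !addNkE (az c1) // (az c2) // !addn0 => /addIn.
Qed.

Hypothesis aperH : aperiodic M.

(** A single aperiodic boundary path at [v] separates [a] from each [b], each time at a finite
    prefix. Disjointness persists under extension, so the prefix at the join of these finitely many
    degrees serves as [g]. *)
Lemma separating_path v (a : L) (U : seq L) : ~ H v -> src a = v ->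
  (forall b, b \in U -> src b = v) ->
  exists g, [/\ rng g = v, ~ H (src g) & forall b, b \in U -> b != a ->
    disjoint_paths (pcomp a g) (pcomp b g)].
Proof.
move=> nHv av Uv; have Pv : v \notin H by apply/negP => /set_mem.
have [x [bx xv sep]] := aperH (exist _ v Pv : vertex M).
have lift b : src b = v -> exists b' : M, val b' = b /\ src b' = prng x.
  move=> bv; have Pb : src b \notin H by rewrite bv.
  by exists (exist _ b Pb); split=> //; rewrite xv; apply/val_inj.
have x0 n : n <=E pdeg x -> rng (val (ppath x 0 n)) = v.
  move=> nx; rewrite -[LHS]/(val (rng (ppath x 0 n))) (bp_rng bx) ?le0Nk //.
  by rewrite -[pvertex x 0]/(prng x) xv.
have [n nx nU] : exists2 n, n <=E pdeg x & forall b, b \in U -> b != a ->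
    disjoint_paths (pcomp a (val (ppath x 0 n))) (pcomp b (val (ppath x 0 n))).
  elim: U Uv => [|b U IH] Uv.
    by exists 0 => //; apply/forallP => i; case: (pdeg x i) => // c; rewrite ffunE.
  have {IH} [m mx mU] := IH (fun c cU => Uv c (mem_behead (s := b :: U) cU)).
  have bv : src b = v by apply: Uv; rewrite mem_head.
  have grow n c : n <=N c -> c <=E pdeg x -> forall b, src b = v ->
      disjoint_paths (pcomp a (val (ppath x 0 n))) (pcomp b (val (ppath x 0 n))) ->
      disjoint_paths (pcomp a (val (ppath x 0 c))) (pcomp b (val (ppath x 0 c))).
    move=> nc cx d dv dis; have nx := leNk_ext_trans nc cx.
    have nn : src (ppath x 0 n) = rng (ppath x n c).
      by rewrite (bp_src bx) ?le0Nk // (bp_rng bx).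
    rewrite (bp_comp bx (le0Nk n) nc cx) val_pcomp_remove //.
    move/composable_remove in nn.
    rewrite !pcompA ?x0 ?av ?dv //.
    by apply: disjoint_paths_pcomp; rewrite // src_pcomp // x0 // ?av ?dv.
  have [->|ba] := eqVneq b a.
    by exists m => // c; rewrite inE => /predU1P[->|/mU//]; rewrite eqxx.
  have [a' [aE a'x]] := lift a av; have [b' [bE b'x]] := lift b bv.
  have [n nx nab] : exists2 n, n <=E pdeg x &
      disjoint_paths (pcomp a (val (ppath x 0 n))) (pcomp b (val (ppath x 0 n))).
    rewrite -aE -bE; apply: concat_disjoint => //; apply: sep.
    - by rewrite a'x xv.
    - by rewrite b'x xv.
    - by move=> ab; case/eqP: ba; rewrite -aE -bE ab.
  have jx : joinNk m n <=E pdeg x by apply: leNk_ext_join.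
  exists (joinNk m n) => // c; rewrite inE => /predU1P[-> _|cU ca].
    by apply: grow nab; rewrite ?leNk_joinr.
  by apply: grow (mU c cU ca); rewrite ?leNk_joinl // Uv // inE cU orbT.
exists (val (ppath x 0 n)); split=> //; first exact: x0.
by move=> /mem_set Hg; have := valP (ppath x 0 n); rewrite Hg.
Qed.

End Separation.

(** * Calculus in the Kumjian-Pask algebra *)

Section KPCalculus.
Variables (K : fieldType) (k : nat) (L : kgraph k).
Hypothesis rf : row_finite L.
Implicit Types (v w : vertex L) (l m a b : L) (n p q N : Nk k) (x y : KP K L).

Local Notation s := (@kp_s K k L).
Local Notation t := (@kp_t K k L).
Local Notation sv v := (s (idp v)).

Let fam : KP_family s t := KP_gen_family K rf.

Lemma KP_elt_ind (P : KP K L -> Prop) :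
  (forall l, P (s l)) -> (forall l, P (t l)) -> P 0 ->
  (forall x y, P x -> P y -> P (x + y)) -> (forall c x, P x -> P (c *: x)) ->
  (forall x y, P x -> P y -> P (x ** y)) -> forall x, P x.
Proof.
move=> Ps Pt P0 PD PZ PM x; rewrite -[x]reprK -kp_eval_gen.
elim: (repr x) => //= [e IH|e IH e' IH'|c e IH|e IH e' IH'].
- by rewrite -scaleN1r; apply: PZ.
- exact: PD.
- exact: PZ.
- exact: PM.
Qed.

Lemma svM v w : sv v ** sv w = if v == w then sv v else 0.
Proof. by case: fam. Qed.

Lemma sM l m : src l = rng m -> s l ** s m = s (pcomp l m).
Proof. by move=> lm; case: fam => _ _ /(_ _ _ lm)[]. Qed.

Lemma tM l m : src l = rng m -> t m ** t l = t (pcomp l m).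
Proof. by move=> lm; case: fam => _ _ /(_ _ _ lm)[]. Qed.

Lemma t_idp v : t (idp v) = sv v.
Proof. by case: fam. Qed.

Lemma ts_Lle n l m : Lle n l -> Lle n m ->
  t l ** s m = if l == m then sv (src l) else 0.
Proof. by case: fam => _ _ _ h _; apply: h. Qed.

Lemma svE v n : sv v = \sum_(l <- fset_set (vL v `&` Lle n)) s l ** t l.
Proof.
rewrite -fsbig_finite; last exact: row_finite_Lle.
by case: fam => _ _ _ _ h; apply: h.
Qed.

Lemma mem_Lle v n l : l \in fset_set (vL v `&` Lle n) -> rng l = v /\ Lle n l.
Proof. by rewrite in_fset_set; [rewrite inE | apply: row_finite_Lle]. Qed.

Lemma sv_s l : sv (rng l) ** s l = s l.
Proof. by rewrite sM ?src_idp // pcomp_idl. Qed.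

Lemma s_sv l : s l ** sv (src l) = s l.
Proof. by rewrite sM ?rng_idp // pcomp_idr. Qed.

Lemma t_sv l : t l ** sv (rng l) = t l.
Proof. by rewrite -t_idp tM ?src_idp // pcomp_idl. Qed.

Lemma sv_t l : sv (src l) ** t l = t l.
Proof. by rewrite -t_idp tM ?rng_idp // pcomp_idr. Qed.

Lemma ts l : t l ** s l = sv (src l).
Proof. by rewrite (ts_Lle (Lle_deg l) (Lle_deg l)) eqxx. Qed.

Lemma sv_s_if v l : sv v ** s l = if v == rng l then s l else 0.
Proof.
case: eqP => [->|/eqP ne]; first exact: sv_s.
by rewrite -(sv_s l) numulA svM (negbTE ne) numul0r.
Qed.

Lemma s_sv_if v l : s l ** sv v = if src l == v then s l else 0.
Proof.
case: eqP => [<-|/eqP ne]; first exact: s_sv.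
by rewrite -(s_sv l) -numulA svM (negbTE ne) numulr0.
Qed.

Lemma sv_t_if v l : sv v ** t l = if v == src l then t l else 0.
Proof.
case: eqP => [->|/eqP ne]; first exact: sv_t.
by rewrite -(sv_t l) numulA svM (negbTE ne) numul0r.
Qed.

Lemma t_sv_if v l : t l ** sv v = if rng l == v then t l else 0.
Proof.
case: eqP => [<-|/eqP ne]; first exact: t_sv.
by rewrite -(t_sv l) -numulA svM (negbTE ne) numulr0.
Qed.

(** Inserting (KP4) at both sources extends [l] and [m] to paths of [Lle n], for n the join of their
    degrees; these are never equal, so (KP3) kills every term. *)
Lemma ts_disjoint l m : disjoint_paths l m -> t l ** s m = 0.
Proof.
move=> dis; pose n := joinNk (deg l) (deg m).
rewrite -(sv_t l) -(s_sv m) !numulA (svE (src l) (subNk n (deg l))).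
rewrite (svE (src m) (subNk n (deg m))) numul_sumr big_seq.
rewrite big1 // => b /mem_Lle[rb bn].
rewrite !numul_suml big_seq big1 // => a /mem_Lle[ra an].
have -> : s a ** t a ** t l ** s m ** (s b ** t b) =
    s a ** (t a ** t l ** (s m ** s b)) ** t b by rewrite !numulA.
rewrite tM // sM // (@ts_Lle n).
- by case: eqP => [/dis[]//|_]; rewrite numulr0 numul0r.
- by apply: Lle_pcomp => //; apply: leNk_joinl.
- by apply: Lle_pcomp => //; apply: leNk_joinr.
Qed.

Definition local_unit_on (F : seq (vertex L)) x : Prop :=
  (\sum_(v <- F) sv v) ** x = x /\ x ** (\sum_(v <- F) sv v) = x.

(** Holding for all larger [F], the statement lets the units of two elements be merged in the
    induction. *)
Lemma ex_local_unit x : exists F0 : seq (vertex L), forall F, uniq F ->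
  {subset F0 <= F} -> local_unit_on F x.
Proof.
have pick F v z : uniq F -> v \in F ->
    \sum_(w <- F) (if w == v then z else 0) = z :> KP K L.
  by move=> uF vF; rewrite (bigD1_seq v) //= eqxx big1 ?addr0 // => w /negbTE->.
have pick' F v z : uniq F -> v \in F ->
    \sum_(w <- F) (if v == w then z else 0) = z :> KP K L.
  by move=> uF vF; under eq_bigr do rewrite eq_sym; apply: pick.
elim/KP_elt_ind: x => [l|l||x y [F hF] [G hG]|c x [F hF]|x y [F hF] [G hG]].
- exists [:: rng l; src l] => F uF sub; rewrite /local_unit_on numul_suml numul_sumr.
  under eq_bigr do rewrite sv_s_if.
  under [X in _ /\ X = _]eq_bigr do rewrite s_sv_if.
  by rewrite pick ?pick' ?sub ?inE ?eqxx ?orbT.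
- exists [:: rng l; src l] => F uF sub; rewrite /local_unit_on numul_suml numul_sumr.
  under eq_bigr do rewrite sv_t_if.
  under [X in _ /\ X = _]eq_bigr do rewrite t_sv_if.
  by rewrite pick ?pick' ?sub ?inE ?eqxx ?orbT.
- by exists [::] => F _ _; split; rewrite ?numul0r ?numulr0.
- exists (F ++ G) => F' uF sub.
  have [Fl Fr] : local_unit_on F' x.
    by apply: hF => // v vF; rewrite sub ?mem_cat ?vF.
  have [Gl Gr] : local_unit_on F' y.
    by apply: hG => // v vF; rewrite sub ?mem_cat ?vF ?orbT.
  by split; rewrite ?numulDl ?numulDr ?Fl ?Fr ?Gl ?Gr.
- exists F => F' uF sub; have [Fl Fr] := hF F' uF sub.
  by split; rewrite -?nuscaleAl -?nuscaleAr ?Fl ?Fr.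
- exists (F ++ G) => F' uF sub.
  have [Fl Fr] : local_unit_on F' x.
    by apply: hF => // v vF; rewrite sub ?mem_cat ?vF.
  have [Gl Gr] : local_unit_on F' y.
    by apply: hG => // v vF; rewrite sub ?mem_cat ?vF ?orbT.
  by split; rewrite ?numulA ?Fl // -numulA Gr.
Qed.

Inductive s_span (P : set L) : KP K L -> Prop :=
| s_span0 : s_span P 0
| s_spanD c l x : P l -> s_span P x -> s_span P (c *: s l + x).

Lemma s_span1 (P : set L) l : P l -> s_span P (s l).
Proof. by move=> Pl; rewrite -(addr0 (s l)) -[s l]scale1r; do 2?constructor. Qed.

Lemma s_span_add P x y : s_span P x -> s_span P y -> s_span P (x + y).
Proof.
by elim=> [|c l {}x Pl _ IH] Py; rewrite ?add0r -?addrA //; constructor; auto.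
Qed.

Lemma s_span_scale P c x : s_span P x -> s_span P (c *: x).
Proof.
elim=> [|d l {}x Pl _ IH]; first by rewrite scaler0; constructor.
by rewrite scalerDr scalerA; constructor.
Qed.

Lemma s_span_lin (P Q : set L) z x : (forall l, P l -> s_span Q (z ** s l)) ->
  s_span P x -> s_span Q (z ** x).
Proof.
move=> zQ; elim=> [|c l {}x Pl _ IH]; first by rewrite numulr0; constructor.
rewrite numulDr -nuscaleAr; apply: s_span_add IH.
by apply: s_span_scale; apply: zQ.
Qed.

Lemma s_spanP P x : s_span P x -> exists (U : seq L) (c : L -> K),
  [/\ uniq U, forall l, l \in U -> P l & x = \sum_(l <- U) c l *: s l].
Proof.
elim=> [|c l {}x Pl _ [U [d [uU UP ->]]]].
  by exists [::], (fun=> 0); split; rewrite ?big_nil.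
have [lU|lU] := boolP (l \in U).
  exists U, (fun m => d m + (if m == l then c else 0)); split=> //.
  under [RHS]eq_bigr do rewrite scalerDl; rewrite big_split addrC; congr +%R.
  rewrite (bigD1_seq l) //= eqxx big1 ?addr0 // => m /negbTE->.
  by rewrite scale0r.
exists (l :: U), (fun m => if m == l then c else d m); split.
- by rewrite /= lU.
- by move=> m; rewrite inE => /predU1P[->|/UP].
rewrite big_cons eqxx; congr +%R; apply: eq_big_seq => m mU.
by case: eqP => // ml; rewrite -ml mU in lU.
Qed.

(* Multiplying by the [s l] of a large enough degree removes all the [t l]. *)
Lemma s_span_mul x N : exists n0, forall n l, n0 <=N n -> Lle n l ->
  s_span [set m | src m = src l /\ exists2 N', N <=N N' & Lle N' m] (x ** s l).
Proof.
elim/KP_elt_ind: x N => [l|l||x y IHx IHy|c x IH|x y IHx IHy] N.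
- exists N => n m Nn mn; rewrite -(s_sv l) -numulA sv_s_if.
  case: eqP => [lm|_]; last by rewrite numulr0; constructor.
  rewrite sM //; apply: s_span1; split; first by rewrite src_pcomp.
  exists (deg l + n); last exact: Lle_pcompl.
  by apply: leNk_trans Nn _; apply/forallP=> i; rewrite addNkE leq_addl.
(* The surplus [deg l] is what [t l] strips off, so the remaining paths still meet the bound [N]. *)
- exists (N + deg l) => n m Nn mn.
  have ln : deg l <=N n.
    by apply: leNk_trans Nn; apply/forallP=> i; rewrite addNkE leq_addl.
  (* (KP4) makes [t l] the sum of the s_b t_(l b), with l b in [Lle n]; by (KP3) only the term with
     l b equal to the given path survives, and it leaves s_b. *)
  rewrite -(sv_t l) (svE _ (subNk n (deg l))) !numul_suml big_seq.
  elim/big_ind: _ => [|y z|b /mem_Lle[rb bn]]; [by constructor|exact: s_span_add|].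
  rewrite -[s b ** t b ** t l]numulA tM // -numulA.
  rewrite (@ts_Lle n) //; last exact: Lle_pcomp.
  case: eqP => [<-|_]; last by rewrite numulr0; constructor.
  rewrite src_pcomp // s_sv; apply: s_span1; split=> //.
  exists (subNk n (deg l)) => //; apply/forallP=> i; have := forallP Nn i.
  by rewrite !(addNkE, ffunE); lia.
- by exists 0 => n l _ _; rewrite numul0r; constructor.
- have [n hn] := IHx N; have [m hm] := IHy N; exists (joinNk n m) => p l np lp.
  rewrite numulDl; apply: s_span_add.
    by apply: hn lp; apply: leNk_trans np; apply: leNk_joinl.
  by apply: hm lp; apply: leNk_trans np; apply: leNk_joinr.
- have [n hn] := IH N; exists n => m l nm lm.
  by rewrite -nuscaleAl; apply: s_span_scale; apply: hn nm lm.
(* The bound [n] that [x] requires is imposed on the output of [y], so that [x] can act on the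
   resulting paths. *)
- have [n hn] := IHx N; have [m hm] := IHy n; exists m => p l mp lp.
  rewrite -numulA; apply: s_span_lin (hm _ _ mp lp) => b [<- [N' nN' bN']].
  exact: hn nN' bN'.
Qed.

(** Local units and (KP4) write [x] as a sum of terms x s_l t_l, and the absorbed elements form an
    ideal. *)
Lemma not_absorbed_mul_s z x n : absorbed z 0 -> ~ absorbed z x ->
  exists2 l, Lle n l & ~ absorbed z (x ** s l).
Proof.
move=> z0 nx; apply: contrapT => no; apply: nx.
have [F hF] := ex_local_unit x; have [||_ <-] := hF (undup F).
- exact: undup_uniq.
- by move=> v; rewrite mem_undup.
rewrite numul_sumr; apply: absorbed_sum => // v _.
rewrite (svE v n) numul_sumr; apply: absorbed_sum => // l /mem_Lle[_ ln].
rewrite numulA; apply: absorbed_mulr; apply: contrapT => nl.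
by apply: no; exists l.
Qed.

End KPCalculus.

(** * Properly infinite elements of KP *)

Section ProperlyInfiniteVertices.
Variables (K : fieldType) (k : nat) (L : kgraph k).
Hypotheses (rf : row_finite L) (lc : locally_convex L).
Implicit Types (v w u : vertex L) (l m g : L) (x y z : KP K L).

Local Notation s := (@kp_s K k L).
Local Notation t := (@kp_t K k L).
Local Notation sv v := (s (idp v)).

Lemma absorbed_zero z : absorbed z 0.
Proof.
have [F hF] := ex_local_unit rf z.
have [|v|Fl Fr] := hF (undup F); rewrite ?undup_uniq ?mem_undup //.
by apply: (@absorbed0 _ _ (\sum_(v <- undup F) sv v) (\sum_(v <- undup F) sv v));
  rewrite Fl Fr.
Qed.

Definition infinite_vertices : set (vertex L) :=
  [set v | absorbed (sv v) (sv v)].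

Lemma infinite_absorbed z v : infinite_vertices v ->
  (exists x y, sv v = x ** z ** y) -> absorbed z (sv v).
Proof.
have [F hF] := ex_local_unit rf z => iv.
have [|w|Fl Fr] := hF (undup F); rewrite ?undup_uniq ?mem_undup //.
by apply: absorbed_idempotent Fl Fr; rewrite // svM // eqxx.
Qed.

Lemma absorbed_hereditary z : hereditary [set v | absorbed z (sv v)].
Proof.
move=> l /= zl; rewrite -(ts K rf) -(sv_s K rf) numulA.
by apply/absorbed_mulr/absorbed_mull.
Qed.

Lemma absorbed_saturated z : saturated [set v | absorbed z (sv v)].
Proof.
move=> v n sub; rewrite /= (svE K rf v n); apply: absorbed_sum => [|l].
  exact: absorbed_zero.
move=> /(mem_Lle rf)[rl ln]; rewrite -(s_sv K rf).
by apply/absorbed_mulr/absorbed_mull/sub; exists l.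
Qed.

(** Each s_(src l) equals t_l s_v s_l, so it is below s_v and, being properly infinite, absorbed by
    it; (KP4) then makes s_v absorb itself. *)
Lemma infinite_saturated : saturated infinite_vertices.
Proof.
move=> v n sub; apply: (absorbed_saturated (n := n)) => _ [l [rl ln] <-].
have iv : infinite_vertices (src l) by apply: sub; exists l.
apply: infinite_absorbed => //; exists (t l), (s l).
by rewrite -rl -(numulA (t l)) (sv_s K rf) (ts K rf).
Qed.

(** Both t_l s_l and t_m s_m equal s_v, while disjointness makes the mixed products vanish. *)
Lemma two_cycles_infinite v l m : rng l = v -> src l = v -> rng m = v ->
  src m = v -> disjoint_paths l m -> disjoint_paths m l -> infinite_vertices v.
Proof.
move=> rl sl rm sm lm ml; exists (t l), (t m), (s l), (s m).
have tl : t l ** sv v = t l by rewrite -rl t_sv.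
have tm : t m ** sv v = t m by rewrite -rm t_sv.
by rewrite tl tm !ts // sl sm !ts_disjoint.
Qed.

Lemma disjoint_paths_sym l m : disjoint_paths l m -> disjoint_paths m l.
Proof. by move=> d a b la mb E; apply: (d b a). Qed.

Lemma bottom_infinite (H : set (vertex L)) (herH : hereditary H) w :
  saturated H -> aperiodic (kgraph_remove herH) -> ~ H w -> vL w <> [set idp w] ->
  (forall u, reach w u -> ~ H u -> reach u w) -> infinite_vertices w.
Proof.
move=> satH aper nHw /nontrivial_path[l rl dl] back.
have [i di] : exists i, deg l i != 0%N.
  apply: contrapT => l0; apply: dl; apply/ffunP => i; rewrite ffunE.
  by apply/eqP/negPn/negP => di; apply: l0; exists i.
have := vLn_rng di; rewrite rl => /(saturated_edge satH nHw)[e [re de] nHe].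
have [|e' [re' se']] := back (src e) _ nHe; first by rewrite -re; apply: reach_path.
have ee' : src e = rng e' by [].
pose c := pcomp e e'.
have cw : src c = w by rewrite src_pcomp.
have wc : rng c = w by rewrite rng_pcomp.
have nc : idp w != c.
  apply/eqP => /(congr1 (fun l => deg l i)); rewrite deg_idp deg_pcomp // de.
  by rewrite !(addNkE, ffunE) eqxx.
(* The cycle [c] and the trivial path at [w] become disjoint after appending [g]; as [g] ends
   outside [H], it can be closed up at [w]. *)
have [||g [rg nHg]] :=
  separating_path (herH := herH) satH aper (a := c) (U := [:: idp w]) nHw.
- by [].
- by move=> b; rewrite inE => /eqP->; rewrite src_idp.
move=> /(_ _ (mem_head _ _) nc) dis.
have [|g' [rg' sg']] := back (src g) _ nHg; first by rewrite -rg; apply: reach_path.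
have gg' : src g = rng g' by [].
have cg : src c = rng g by rewrite cw.
have wg : src (idp w) = rng g by rewrite src_idp.
have scg : src (pcomp c g) = rng g' by rewrite src_pcomp.
have swg : src (pcomp (idp w) g) = rng g' by rewrite src_pcomp.
have {}dis := disjoint_paths_pcomp scg swg dis.
apply: (two_cycles_infinite _ _ _ _ dis (disjoint_paths_sym dis)).
- by rewrite rng_pcomp // rng_pcomp.
- by rewrite src_pcomp.
- by rewrite rng_pcomp // rng_pcomp // rng_idp.
- by rewrite src_pcomp.
Qed.

Hypothesis aper : strongly_aperiodic L.
Hypothesis fin : forall v : vertex L, finite_set (vertices_above v).
Hypothesis nosink : forall v : vertex L, vL v <> [set idp v].

(* A vertex [w] outside the core that sees as few vertices as possible is reached
   back from every vertex outside the core that it sees. So [L \ L core] has a cycle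
   at [w]; separating it from the trivial path at [w] and returning to [w] gives
   two disjoint cycles. *)
Lemma vertex_infinite v : infinite_vertices v.
Proof.
pose H := core infinite_vertices.
have herH : hereditary H by apply: core_hereditary.
have satH : saturated H by apply: core_saturated lc infinite_saturated.
have [/(_ v (reach_refl v))//|/(bottom_vertex fin (P := ~` H))] := EM (H v).
move=> [w [_ nHw back]]; exfalso; apply: nHw => u wu.
have [/(_ u (reach_refl u))//|nHu] := EM (H u).
(* The vertex [u] inherits minimality from [w]: what it sees outside [H] sees [w], hence [u]. *)
apply: (bottom_infinite satH (@aper _ herH satH) nHu (@nosink u)) => u' uu' nHu'.
by apply: reach_trans (wu); apply: (back _ _ nHu'); apply: reach_trans uu'.
Qed.

(* A path separating one [l] with [c l != 0] from the others kills all other terms. *)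
Lemma compress_to_vertex (H : set (vertex L)) (herH : hereditary H) v
    (U : seq L) (c : L -> K) : saturated H -> aperiodic (kgraph_remove herH) ->
  ~ H v -> uniq U -> (forall l, l \in U -> src l = v) ->
  \sum_(l <- U) c l *: s l != 0 ->
  exists x y w, ~ H w /\ x ** (\sum_(l <- U) c l *: s l) ** y = sv w.
Proof.
move=> satH aperH nHv uU Uv ne0.
have [l lU cl] : exists2 l, l \in U & c l != 0.
  apply: contrapT => no; case/eqP: ne0; rewrite big_seq big1 // => l lU.
  have [->|cl] := eqVneq (c l) 0; first by rewrite scale0r.
  by case: no; exists l.
have [g [rg nHg dis]] := separating_path satH aperH nHv (Uv l lU) Uv.
exists ((c l)^-1 *: t (pcomp l g)), (s g), (src g); split=> //.
have E m : m \in U -> (c l)^-1 *: t (pcomp l g) ** (c m *: s m) ** s g =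
    ((c l)^-1 * c m) *: (t (pcomp l g) ** s (pcomp m g)).
  move=> mU; rewrite -!nuscaleAr -!nuscaleAl scalerA mulrC -numulA sM //.
  by rewrite Uv.
rewrite numul_sumr numul_suml (bigD1_seq l) //= [X in _ + X]big_seq_cond.
rewrite big1 ?addr0 => [|m /andP[mU ml]].
  by rewrite E // mulVf // scale1r ts // src_pcomp // Uv.
by rewrite E // ts_disjoint ?scaler0 //; apply: dis.
Qed.

Lemma KP_properly_purely_infinite : properly_purely_infinite (KP K L).
Proof.
move=> z z0; apply/properly_infiniteE; split=> //; apply: contrapT => nz.
pose H := [set v | absorbed z (sv v)].
have satH : saturated H by apply: absorbed_saturated.
have herH : hereditary H by apply: absorbed_hereditary.
have [n hn] := s_span_mul rf z 0.
have [l ln nl] := not_absorbed_mul_s rf n (absorbed_zero z) nz.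
have [U [c [uU UP E]]] := s_spanP (hn _ _ (leNk_refl n) ln).
have nHv : ~ H (src l).
  by move=> Hv; apply: nl; rewrite -(s_sv K rf) numulA; apply: absorbed_mull.
have ne0 : z ** s l != 0.
  by apply/eqP => e0; apply: nl; rewrite e0; apply: absorbed_zero.
have Uv m : m \in U -> src m = src l by move=> /UP[].
have := compress_to_vertex (c := c) satH (@aper _ herH satH) nHv uU Uv.
rewrite -E => /(_ ne0)[x [y [w [nHw Ew]]]]; apply: nHw.
apply: infinite_absorbed; first exact: vertex_infinite.
by exists x, (s l ** y); rewrite -Ew !numulA.
Qed.

End ProperlyInfiniteVertices.

(** * Nonvanishing at a sink *)

Section LinearEndomorphisms.
Variables (K : fieldType) (V : lmodType K).

(** These endomorphisms form the algebra in which [KP K L] is represented. *)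
Record lend := Lend { lend_fun :> V -> V; lend_linear : linear lend_fun }.

Lemma lendP (f g : lend) : f =1 g -> f = g.
Proof.
case: f g => [f lf] [g lg] /= /funext fg; rewrite -{}fg in lg *.
by congr Lend; apply: Prop_irrelevance.
Qed.

HB.instance Definition _ := gen_eqMixin lend.
HB.instance Definition _ := gen_choiceMixin lend.

Lemma lend0_subproof : linear (fun _ : V => 0 : V).
Proof. by move=> c x y; rewrite scaler0 addr0. Qed.
Lemma lendN_subproof (f : lend) : linear (fun x => - f x).
Proof. by move=> c x y; rewrite lend_linear opprD scalerN. Qed.
Lemma lendD_subproof (f g : lend) : linear (fun x => f x + g x).
Proof. by move=> c x y; rewrite !lend_linear scalerDr addrACA. Qed.
Lemma lendZ_subproof (a : K) (f : lend) : linear (fun x => a *: f x).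
Proof.
by move=> c x y; rewrite lend_linear scalerDr !scalerA mulrC.
Qed.
Lemma lendM_subproof (f g : lend) : linear (fun x => f (g x)).
Proof. by move=> c x y; rewrite !lend_linear. Qed.

Definition lend_zero := Lend lend0_subproof.
Definition lend_opp f := Lend (lendN_subproof f).
Definition lend_add f g := Lend (lendD_subproof f g).
Definition lend_scale a f := Lend (lendZ_subproof a f).
Definition lend_mul f g := Lend (lendM_subproof f g).

Lemma lendE0 (f : lend) : f 0 = 0.
Proof. by have := lend_linear f (-1) 0 0; rewrite scaler0 addr0 scaleN1r addNr. Qed.
Lemma lendED (f : lend) x y : f (x + y) = f x + f y.
Proof. by have := lend_linear f 1 x y; rewrite !scale1r. Qed.
Lemma lendEZ (f : lend) c x : f (c *: x) = c *: f x.
Proof. by have := lend_linear f c x 0; rewrite !addr0 lendE0 addr0. Qed.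

Lemma lend_addA : associative lend_add.
Proof. by move=> f g h; apply: lendP => x; apply: addrA. Qed.
Lemma lend_addC : commutative lend_add.
Proof. by move=> f g; apply: lendP => x; apply: addrC. Qed.
Lemma lend_add0 : left_id lend_zero lend_add.
Proof. by move=> f; apply: lendP => x; apply: add0r. Qed.
Lemma lend_addN : left_inverse lend_zero lend_opp lend_add.
Proof. by move=> f; apply: lendP => x; apply: addNr. Qed.

HB.instance Definition _ :=
  GRing.isZmodule.Build lend lend_addA lend_addC lend_add0 lend_addN.

Lemma lend_scaleA a b f : lend_scale a (lend_scale b f) = lend_scale (a * b) f.
Proof. by apply: lendP => x; apply: scalerA. Qed.
Lemma lend_scale1 : left_id 1 lend_scale.
Proof. by move=> f; apply: lendP => x; apply: scale1r. Qed.
Lemma lend_scaleDr : right_distributive lend_scale +%R.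
Proof. by move=> a f g; apply: lendP => x; apply: scalerDr. Qed.
Lemma lend_scaleDl f : {morph lend_scale^~ f : a b / a + b}.
Proof. by move=> a b; apply: lendP => x; apply: scalerDl. Qed.

HB.instance Definition _ := GRing.Zmodule_isLmodule.Build K lend
  lend_scaleA lend_scale1 lend_scaleDr lend_scaleDl.

Lemma lend_mulA : associative lend_mul.
Proof. by move=> f g h; apply: lendP. Qed.
Lemma lend_mulDl : left_distributive lend_mul +%R.
Proof. by move=> f g h; apply: lendP. Qed.
Lemma lend_mulDr : right_distributive lend_mul +%R.
Proof. by move=> f g h; apply: lendP => x; apply: lendED. Qed.

HB.instance Definition _ :=
  Zmodule_isNuRing.Build lend lend_mulA lend_mulDl lend_mulDr.

Lemma lend_scaleAl (c : K) (f g : lend) : c *: (f ** g) = (c *: f) ** g.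
Proof. by apply: lendP. Qed.
Lemma lend_scaleAr (c : K) (f g : lend) : c *: (f ** g) = f ** (c *: g).
Proof. by apply: lendP => x; apply/esym/lendEZ. Qed.

HB.instance Definition _ :=
  NuRing_isNuAlgebra.Build K lend lend_scaleAl lend_scaleAr.

Lemma lend_sumE (I : Type) (r : seq I) (F : I -> lend) x :
  (\sum_(i <- r) F i) x = \sum_(i <- r) F i x.
Proof. by elim: r => [|i r IH]; rewrite ?big_nil ?big_cons // -IH. Qed.

End LinearEndomorphisms.

(* [KP K L] acts on the functions on the paths ending at a sink [v]; here these
   are the functions on all paths, the values at other paths being ignored. *)
Section SinkRepresentation.
Variables (K : fieldType) (k : nat) (L : kgraph k) (v : vertex L).
Hypotheses (rf : row_finite L) (lc : locally_convex L).
Hypothesis sink : forall i, vLn v (eNk i) = set0.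
Implicit Types (l m a b x : L).

(** The partial inverse of prefixing by [l]; unique factorisation makes the remainder independent of
    the choice. *)
Definition strip l x : option L :=
  if pselect (exists m, src l = rng m /\ pcomp l m = x) is left e
  then Some (projT1 (cid e)) else None.

Lemma strip_pcomp l m : src l = rng m -> strip l (pcomp l m) = Some m.
Proof.
move=> lm; rewrite /strip; case: pselect => [e|[]]; last by exists m.
case: cid => m' /= [lm' E]; congr Some.
by have [] := factor_inj lm' lm E erefl.
Qed.

Lemma strip_none l x : (forall m, src l = rng m -> pcomp l m <> x) ->
  strip l x = None.
Proof.
by move=> no; rewrite /strip; case: pselect => // -[m [lm E]]; case: (no m).
Qed.

Variant strip_spec l x : option L -> Prop :=
| StripSome m of src l = rng m & x = pcomp l m : strip_spec l x (Some m)
| StripNone of (forall m, src l = rng m -> pcomp l m <> x) : strip_spec l x None.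

Lemma stripP l x : strip_spec l x (strip l x).
Proof.
have [[m [lm <-]]|no] := EM (exists m, src l = rng m /\ pcomp l m = x).
  by rewrite strip_pcomp //; constructor.
have no' m : src l = rng m -> pcomp l m <> x by move=> lm E; apply: no; exists m.
by rewrite strip_none //; constructor.
Qed.

Local Notation V := (L -> K^o).

(** For [m] composable with [l] and ending at [v], the indicator of m goes to that of l m;
    [sink_t_fun] reverses this. *)
Definition sink_s_fun l (f : V) : V :=
  fun x => if src x == v then oapp f 0 (strip l x) else 0.

Definition sink_t_fun l (f : V) : V :=
  fun x => if (src l == rng x) && (src x == v) then f (pcomp l x) else 0.

Lemma sink_s_subproof l : linear (sink_s_fun l).
Proof.
move=> c f g; apply/funext => x.
rewrite -[RHS]/(c * sink_s_fun l f x + sink_s_fun l g x) /sink_s_fun.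
by case: ifP => _; [case: (strip l x) => [m|] /=|]; rewrite ?mulr0 ?addr0.
Qed.

Lemma sink_t_subproof l : linear (sink_t_fun l).
Proof.
move=> c f g; apply/funext => x.
rewrite -[RHS]/(c * sink_t_fun l f x + sink_t_fun l g x) /sink_t_fun.
by case: ifP => _; rewrite ?mulr0 ?addr0.
Qed.

Definition sink_s l : lend V := Lend (sink_s_subproof l).
Definition sink_t l : lend V := Lend (sink_t_subproof l).

Lemma sink_s_idp w (f : V) x :
  sink_s (idp w) f x = if (w == rng x) && (src x == v) then f x else 0.
Proof.
rewrite /= /sink_s_fun andbC; case: (src x == v) => //=.
case: stripP => [m wm ->|no] /=.
  by rewrite src_idp in wm; rewrite wm pcomp_idl eqxx.
case: eqP => // wx; case: (no x); rewrite ?src_idp // wx; exact: pcomp_idl.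
Qed.

Lemma sink_t_s l m (f : V) x :
  (sink_t l ** sink_s m) f x =
  if (src l == rng x) && (src x == v) then oapp f 0 (strip m (pcomp l x)) else 0.
Proof.
rewrite -[LHS]/(sink_t_fun l (sink_s_fun m f) x) /sink_t_fun /sink_s_fun.
by case: eqP => //= lx; case: eqP => //= xv; rewrite src_pcomp // xv eqxx.
Qed.

Lemma sink_s_t l (f : V) a b : src l = rng b -> src b = v ->
  (sink_s l ** sink_t l) f (pcomp l b) = f (pcomp l b).
Proof.
move=> lb bv.
rewrite -[LHS]/(sink_s_fun l (sink_t_fun l f) (pcomp l b)) /sink_s_fun.
by rewrite src_pcomp // bv eqxx strip_pcomp //= /sink_t_fun lb bv !eqxx.
Qed.

Lemma sink_family : KP_family sink_s sink_t.
Proof.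
have funP (f g : lend V) : (forall h x, f h x = g h x) -> f = g.
  by move=> fg; apply: lendP => h; apply/funext.
split.
- move=> w; apply: funP => f x; rewrite sink_s_idp /= /sink_t_fun src_idp.
  by case: eqP => //= ->; rewrite pcomp_idl.
- move=> w w'; apply: funP => f x.
  rewrite -[LHS]/(sink_s (idp w) (sink_s (idp w') f) x).
  rewrite !sink_s_idp; case: (w =P w') => [->|]; rewrite ?sink_s_idp.
    by case: (_ && _).
  move=> ww'; case: ifP => // /andP[/eqP wx _]; case: eqP => // w'x.
  by case: ww'; rewrite wx w'x.
- move=> l m lm; split; apply: funP => f x.
    rewrite -[LHS]/(sink_s_fun l (sink_s_fun m f) x) -[RHS]/(sink_s_fun _ f x).
    rewrite /sink_s_fun; case: eqP => // xv.
    case: (stripP l x) => [y ly xE|no] /=; last first.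
      rewrite strip_none // => y my E; rewrite src_pcomp // in my.
      by apply: (no (pcomp m y)); rewrite ?rng_pcomp // pcompA.
    have -> : src y == v by rewrite -xv xE src_pcomp.
    case: (stripP m y) => [z mz yE|no] /=.
      by rewrite xE yE pcompA // strip_pcomp // src_pcomp.
    rewrite strip_none // => z mz E; rewrite src_pcomp // in mz.
    have /factor_inj[] // : pcomp l y = pcomp l (pcomp m z) by rewrite pcompA // E.
      by rewrite rng_pcomp.
    by move=> _ yE; apply: (no z).
  rewrite -[LHS]/(sink_t_fun m (sink_t_fun l f) x) -[RHS]/(sink_t_fun _ f x).
  rewrite /sink_t_fun (src_pcomp lm); case: (src m =P rng x) => //= mx.
  by rewrite rng_pcomp // lm eqxx src_pcomp //= pcompA //; case: (_ == v).
- move=> n l m ln mn; apply: funP => f x; rewrite sink_t_s.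
  have [<-|lm] := eqVneq l m.
    by rewrite sink_s_idp; case: eqP => //= lx; rewrite strip_pcomp.
  case: ifP => // /andP[/eqP lx _]; case: stripP => //= y my E.
  by case/eqP: lm; apply: Lle_prefix_inj ln mn lx my E.
move=> w n; rewrite fsbig_finite; last exact: row_finite_Lle.
apply: funP => f x; rewrite lend_sumE fct_sumE sink_s_idp.
set U := fset_set _; have memU l : l \in U = `[< rng l = w /\ Lle n l >].
  rewrite in_fset_set; last exact: row_finite_Lle.
  by apply/idP/asboolP; rewrite inE.
have term0 l : (src x = v -> forall m, src l = rng m -> pcomp l m <> x) ->
    (sink_s l ** sink_t l) f x = 0.
  rewrite -[X in _ -> X = _]/(sink_s_fun l _ x) /sink_s_fun.
  by case: eqP => // xv /(_ xv)/strip_none->.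
case: (@andP (w == rng x) (src x == v)) => [[/eqP wx /eqP xv]|no]; last first.
  rewrite big_seq big1 // => l; rewrite memU => /asboolP[lw _]; apply: term0.
  by move=> xv m lm E; case: no; rewrite xv -E rng_pcomp // lw !eqxx.
(* Nothing can be appended to [x] at the sink, so [x] is in [Lle] of any bound above its degree and
   has a prefix [a] in [Lle n]. By [Lle_prefix_inj] this gives the only term of (KP4) alive at
   [x]. *)
have [||a [b [ab xE an]]] := @Lle_prefix _ L n (joinNk n (deg x)) x lc.
- exact: leNk_joinl.
- by apply: Lle_source; rewrite ?xv ?leNk_joinr.
have aU : a \in U by rewrite memU; apply/asboolP; rewrite wx xE rng_pcomp.
rewrite (bigD1_seq a) ?fset_uniq //= big_seq_cond big1 ?addr0.
  by rewrite xE; apply/esym/sink_s_t; rewrite // -xv xE src_pcomp.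
move=> l; rewrite memU => /andP[/asboolP[_ ln] /eqP la]; apply: term0 => _ m lm E.
by apply: la; apply: Lle_prefix_inj ln an lm ab _; rewrite E.
Qed.

Lemma sink_nonzero : kp_s K (idp v) != 0.
Proof.
have [[fD _ _] fs _] := KP_universal sink_family.
have f0 : kp_lift sink_s sink_t 0 = 0.
  by apply: (addIr (kp_lift sink_s sink_t 0)); rewrite -fD !add0r.
apply/eqP => s0; have := fs (idp v); rewrite s0 f0.
(* The constant function 1 is sent by s_v to a function with value 1 at the trivial path. *)
move=> /(congr1 (fun g : lend V => g (fun=> 1) (idp v))).
rewrite sink_s_idp rng_idp src_idp eqxx => /eqP.
by rewrite eq_sym oner_eq0.
Qed.

End SinkRepresentation.

(** * Sinks and cycles *)

Section CentralIdempotent.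
Variables (K : fieldType) (A : nuAlgType K) (e : A).

Definition annihilator : {pred A} := [pred x | e ** x == 0].

Lemma annihilator_zmod_closed : zmod_closed annihilator.
Proof.
split=> [|x y]; rewrite !inE ?numulr0 // => /eqP ex /eqP ey.
by rewrite numulDr numulrN ex ey subr0.
Qed.

HB.instance Definition _ :=
  GRing.isZmodClosed.Build A annihilator annihilator_zmod_closed.

Hypothesis central : forall x, e ** x = x ** e.

Lemma annihilator_mull a x : x \in annihilator -> a ** x \in annihilator.
Proof. by rewrite !inE numulA (central a) -numulA => /eqP->; rewrite numulr0. Qed.

Lemma annihilator_mulr a x : x \in annihilator -> x ** a \in annihilator.
Proof. by rewrite !inE numulA => /eqP->; rewrite numul0r. Qed.

Definition annihilator_ideal : nuideal A :=
  NuIdeal (nuideal_zmod := annihilator) annihilator_mull annihilator_mulr.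

(** For a central idempotent, the quotient by the annihilator is the corner e A, here the copy K e
    of the field. *)
Lemma division_ring_quotient : e != 0 -> e ** e = e ->
  (forall x, exists c : K, e ** x = c *: e) ->
  division_ring (nuquot annihilator_ideal).
Proof.
move=> e0 ee corner; set Q := nuquot _.
pose q : A -> Q := \pi_Q%qT.
have qM x y : q (x ** y) = q x ** q y by exact: (@pi_nuquot_mul _ annihilator_ideal).
have qE x y : (q x = q y) <-> e ** x = e ** y.
  split=> [/eqmodP|E].
    rewrite /= Quotient.equivE inE numulDr numulrN => /eqP/(canRL (addrNK _)).
    by rewrite add0r.
  by apply/eqmodP; rewrite /= Quotient.equivE inE numulDr numulrN E addrN.
have q0 : q 0 = 0 by exact: (raddf0 (\pi_(Quotient.quot annihilator_ideal)%qT)).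
have eU x : e ** (e ** x) = e ** x by rewrite numulA ee.
exists (q e); split.
- by apply/eqP; rewrite -q0 => /qE; rewrite ee numulr0; apply/eqP.
- move=> x; rewrite -[x]reprK -[\pi_Q%qT _]/(q _) -!qM; split; apply/qE => //.
  by rewrite -central eU.
move=> x; rewrite -[x]reprK -[\pi_Q%qT _]/(q _) => x0.
have [c ec] := corner (repr x).
have c0 : c != 0.
  apply: contraNneq x0 => c0; rewrite -q0; apply/eqP/qE.
  by rewrite ec c0 scale0r numulr0.
(* Modulo the annihilator, [x] equals c e. *)
exists (q (c^-1 *: e)); rewrite -!qM; split; apply/qE.
  by rewrite numulA ec -!nuscaleAr -!nuscaleAl !ee scalerA mulVf // scale1r.
by rewrite -nuscaleAl -!nuscaleAr eU ec scalerA mulVf // scale1r ee.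
Qed.

End CentralIdempotent.

(** * The corner at a sink *)

Section Sinks.
Variables (K : fieldType) (k : nat) (L : kgraph k) (v : vertex L).
Hypotheses (rf : row_finite L) (lc : locally_convex L).
Hypothesis vLE : vL v = [set idp v].
Implicit Types (l m : L) (x y : KP K L).

Local Notation s := (@kp_s K k L).
Local Notation t := (@kp_t K k L).
Local Notation e := (s (idp v)).

Lemma sink_path l : rng l = v -> l = idp v.
Proof. by move=> lv; have : vL v l by []; rewrite vLE. Qed.

Lemma sink_no_edge i : vLn v (eNk i) = set0.
Proof.
apply/seteqP; split=> // l [/sink_path->]; rewrite deg_idp => /ffunP/(_ i).
by rewrite !ffunE eqxx.
Qed.

Lemma sink_ne0 : e != 0.
Proof. exact: sink_nonzero rf lc sink_no_edge. Qed.

Lemma sink_ee : e ** e = e.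
Proof. by rewrite svM // eqxx. Qed.

(** At a sink the trivial path is in every [Lle n], so x s_v is a combination of elements s_l, and
    multiplying by s_v on the left keeps only l = v. *)
Lemma sink_corner x : exists c : K, e ** x ** e = c *: e.
Proof.
have [n hn] := s_span_mul rf x 0.
have := hn n (idp v) (leNk_refl n) (Lle_idp n sink_no_edge).
rewrite -numulA src_idp; elim=> [|c l y [lv _] _ [d E]].
  by exists 0; rewrite numulr0 scale0r.
rewrite numulDr E -nuscaleAr sv_s_if //; case: eqP => [vl|_].
  by exists (c + d); rewrite scalerDl (sink_path (esym vl)).
by exists d; rewrite scaler0 add0r.
Qed.

(** The vertex is isolated: any other generator is killed by s_v on both sides. *)
Lemma sink_central : (forall l, src l = v -> l = idp v) ->
  forall x, e ** x = x ** e.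
Proof.
move=> Lv; elim/KP_elt_ind => [l|l||x y Ex Ey|c x E|x y Ex Ey].
- rewrite sv_s_if // s_sv_if //; case: eqP => [/esym/sink_path->|vl].
    by rewrite src_idp eqxx.
  by case: eqP => // /Lv lE; case: vl; rewrite lE rng_idp.
- rewrite sv_t_if // t_sv_if //; case: eqP => [/esym/Lv->|vl].
    by rewrite rng_idp eqxx.
  by case: eqP => // /sink_path lE; case: vl; rewrite lE src_idp.
- by rewrite numulr0 numul0r.
- by rewrite numulDr numulDl Ex Ey.
- by rewrite -nuscaleAr -nuscaleAl E.
- by rewrite numulA Ex -numulA Ey numulA.
Qed.

(* If another path [l] ends at the sink, then [e + s l ** t l] has rank two in the
   matrix units spanning the ideal generated by [e], so it is not below [e]. *)
Lemma sink_not_purely_infinite : ~ purely_infinite (KP K L).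
Proof.
move=> [nodiv prec].
have [[l [lv l1]]|no] := EM (exists l, src l = v /\ l <> idp v); last first.
  have Lv l : src l = v -> l = idp v.
    by move=> lv; apply: contrapT => l1; apply: no; exists l.
  apply: (nodiv (annihilator_ideal (sink_central Lv))).
  apply: division_ring_quotient sink_ne0 sink_ee _ => x.
  have [c E] := sink_corner x; exists c.
  by rewrite -E -numulA -sink_central // numulA sink_ee.
have esl : e ** s l = 0.
  by rewrite sv_s_if //; case: eqP => // /esym/sink_path.
have sle : s l ** e = s l by rewrite -lv s_sv.
have etl : e ** t l = t l by rewrite -lv sv_t.
have tsl : t l ** s l = e by rewrite ts // lv.
have /prec/mxprecsim11[x [y E]] : RaR e (e + s l ** t l).
  exists [:: (e, e); (s l, t l)]; rewrite !big_cons big_nil /= addr0.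
  by rewrite !sink_ee sle.
(* Compressing E by [e] and [t l] on the left and by [e] and [s l] on the right makes the 2 by 2
   identity matrix the product of the column (a, a') and the row (b, b'). *)
have [a aE] := sink_corner x; have [b bE] := sink_corner y.
have [a' a'E] := sink_corner (t l ** x); have [b' b'E] := sink_corner (y ** s l).
have inj c d : c *: e = d *: e -> c = d.
  move=> /eqP; rewrite -subr_eq0 -scalerBl scaler_eq0 (negbTE sink_ne0) orbF.
  by rewrite subr_eq0 => /eqP.
have split_b u z : u ** (e + s l ** t l) ** z = (u ** x ** e) ** (e ** (y ** z)).
  by rewrite E !numulA -[_ ** e ** e]numulA sink_ee.
have eb : e ** (e + s l ** t l) = e.
  by rewrite numulDr sink_ee numulA esl numul0r addr0.
have ysl : e ** (y ** s l) = b' *: e by rewrite -b'E -!numulA sle.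
have ab1 : a * b = 1.
  apply: inj; rewrite -scalerA -bE -numulA scale1r; have := split_b e e.
  by rewrite eb sink_ee aE -nuscaleAl [e ** (e ** _)]numulA sink_ee => <-.
have ab0 : a * b' = 0.
  apply: inj; rewrite scale0r -scalerA; have := split_b e (s l).
  by rewrite eb esl aE ysl -nuscaleAl -nuscaleAr sink_ee => <-.
have ab1' : a' * b' = 1.
  apply: inj; rewrite scale1r -scalerA; have := split_b (t l) (s l).
  rewrite ysl numulDr numulDl -numulA esl numulr0 add0r numulA tsl.
  rewrite -numulA tsl sink_ee.
  have -> : t l ** x ** e = a' *: e by rewrite -a'E numulA etl.
  by rewrite -nuscaleAl -nuscaleAr sink_ee => <-.
have a0 : a != 0 by apply: contra_eq_neq ab1 => ->; rewrite mul0r eq_sym oner_eq0.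
move: ab0 => /eqP; rewrite mulf_eq0 (negbTE a0) /= => /eqP b0.
by move: ab1' => /eqP; rewrite b0 mulr0 eq_sym oner_eq0.
Qed.

End Sinks.

(** * Cycles and nontrivial paths *)

Section Cycles.
Variables (k : nat) (L : kgraph k).

(** A vertex below [v] that sees as few vertices as possible is seen by all it sees, so a nontrivial
    path there closes up to a cycle. *)
Lemma reached_from_cycle :
  (forall v : vertex L, finite_set (vertices_above v)) ->
  (forall v : vertex L, vL v <> [set idp v]) ->
  forall v : vertex L, exists mu : L, is_cycle mu /\ reached_from v mu.
Proof.
move=> fin nosink v.
have [w [vw _ back]] := bottom_vertex (P := setT) (v := v) fin I.
have [l lw dl] := nontrivial_path (@nosink w).
have [|m [ml mw]] := back (src l) _ I; first by rewrite -lw; apply: reach_path.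
exists (pcomp l m); split; first by apply: cycle_reaches; rewrite // lw.
by rewrite /reached_from src_pcomp // mw.
Qed.

Lemma cycle_nontrivial (v : vertex L) (mu : L) :
  is_cycle mu -> reached_from v mu -> vL v <> [set idp v].
Proof.
move=> [nid smu] [l [rl sl]] vE; apply: nid; exists v => //.
have lE : l = idp v by have : vL v l by []; rewrite vE.
have : vL v mu by rewrite /vL /= -smu -sl lE src_idp.
by rewrite vE.
Qed.

End Cycles.

Theorem proposition4p6 (k : nat) (L : kgraph k) (K : fieldType)
    (hk : (0 < k)%N) (hconv : locally_convex L) (hrow : row_finite L)
    (haper : strongly_aperiodic L)
    (hfin : forall v : vertex L, finite_set (vertices_above v)) :
  [<-> forall v : vertex L, vL v <> [set idp v];
       forall v : vertex L, exists mu : L, is_cycle mu /\ reached_from v mu;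
       properly_purely_infinite (KP K L);
       purely_infinite (KP K L)].
Proof.
tfae.
- exact: reached_from_cycle hfin.
(* Cycles enter only through the nontrivial paths they provide at every vertex. *)
- move=> cyc; apply: KP_properly_purely_infinite => // v.
  by have [mu [mucyc /cycle_nontrivial]] := cyc v; apply.
- exact: properly_purely_infiniteP.
- by move=> pi v vE; apply: (sink_not_purely_infinite (K := K)) vE pi.
Qed.
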